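(* If $f:(\mathcal A_1,\wedge_1,\delta_1,\Delta_1,[\cdot\bullet\cdot]_{\Delta_1})\to(\mathcal A_2,\wedge_2,\delta_2,\Delta_2,[\cdot\bullet\cdot]_{\Delta_2})$ is a homomorphism of two DGBV algebras in $\mathcal{DGBV}_q$, then $$f_*(\alpha\wedge_x\beta)=f_*(\alpha)\wedge_{f_*(x)}f_*(\beta),$$ where $\alpha,\beta,x\in H(\mathcal A_1,\delta_1)$, and $f_*:H(\mathcal A_1,\delta_1)\to H(\mathcal A_2,\delta_2)$ is the homomorphism on cohomology induced by $f$.
   Context: Let $\mathbf k$ be a graded commutative associative algebra with unit over $\mathbb Q$, and $(\mathcal A,\wedge)$ a graded commutative associative algebra with unit $1$ over $\mathbf k$; $|a|$ denotes the degree of a homogeneous element $a$. DGBV algebras: for a linear operator $\Delta$ of odd degree on $\mathcal A$ set $[a\bullet b]=[a\bullet b]_\Delta=(-1)^{|a|}\big(\Delta(a\wedge b)-(\Delta a)\wedge b-(-1)^{|a|}a\wedge\Delta b\big)$ for homogeneous $a,b$. If $\Delta^2=0$ and $[a\bullet(b\wedge c)]=[a\bullet b]\wedge c+(-1)^{(|a|-1)|b|}b\wedge[a\bullet c]$ for all homogeneous $a,b,c$, then $(\mathcal A,\wedge,\Delta,[\cdot\bullet\cdot])$ is a GBV algebra. A DGBV algebra is a GBV algebra with a $\mathbf k$-linear derivation $\delta$ of odd degree with respect to $\wedge$ such that $\delta^2=\delta\Delta+\Delta\delta=0$. Homomorphisms of DGBV algebras are defined in the evident way (maps respecting all of this structure).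 $H(\mathcal A,\delta)=\operatorname{Ker}\delta/\operatorname{Im}\delta$, with the product induced by $\wedge$. The category $\mathcal{DGBV}_q$: the DGBV algebras satisfying $\operatorname{Im}\delta\Delta=\operatorname{Im}\Delta\delta=\operatorname{Im}\delta\cap\operatorname{Ker}\Delta=\operatorname{Im}\Delta\cap\operatorname{Ker}\delta$ (equivalently, the inclusions $(\operatorname{Ker}\Delta,\delta)\hookrightarrow(\mathcal A,\delta)$ and $(\operatorname{Ker}\delta,\Delta)\hookrightarrow(\mathcal A,\Delta)$ induce isomorphisms of homology). The deformed product $\wedge_x$ on the cohomology of an algebra $\mathcal A$ in $\mathcal{DGBV}_q$. For an even class $x\in H(\mathcal A,\delta)$ there is a series $x(t)=x_1t+x_2t^2+\cdots\in\mathcal A[[t]]$ with even coefficients such that $\delta x(t)+\frac12[x(t)\bullet x(t)]=0$, $x_1\in\operatorname{Ker}\Delta\cap\operatorname{Ker}\delta$ represents $x$, and $x_n\in\operatorname{Im}\Delta$ for $n>1$. Then $\delta_{x(t)}=\delta+[x(t)\bullet\cdot]$ is a differential and a derivation of $\mathcal A[[t]]$. There is an isomorphism of $\mathbf k[[t]]$-modules $\phi_{x(t)}:H(\mathcal A,\delta)[[t]]\to H(\mathcal A[[t]],\delta_{x(t)})$: represent $[y]\in H(\mathcal A,\delta)$ by $y_0\in\operatorname{Ker}\delta\cap\operatorname{Ker}\Delta$, extend it to $y(t)=y_0+y_1t+\cdots$ with $\delta_{x(t)}y(t)=0$ and $y_n\in\operatorname{Im}\Delta$ for $n\ge1$, set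 $\phi_{x(t)}([y])=[y(t)]$ (well defined), and extend to power series in $t$. The formal deformation $\wedge_{x(t)}$ of $\wedge$ is $$a\wedge_{x(t)}b=\phi_{x(t)}^{-1}\big(\phi_{x(t)}(a)\wedge\phi_{x(t)}(b)\big)$$ on $H(\mathcal A,\delta)[[t]]$. For an odd class $x$ the same construction is made with an odd indeterminate $\epsilon$ in place of $t$: elements of $\mathcal A[[\epsilon]]$ have the form $a_0+a_1\epsilon$, operations are extended by the Koszul sign convention, and $x(\epsilon)=x_1\epsilon$, with $x_1\in\operatorname{Ker}\delta\cap\operatorname{Ker}\Delta$ representing $x$, satisfies $\delta x(\epsilon)+\frac12[x(\epsilon)\bullet x(\epsilon)]=0$. The equivalence class of the deformation $\wedge_{x(t)}$ depends only on the cohomology class $x$, and $\wedge_x$ denotes the deformation so determined by $x$. The map $f_*$ is extended coefficientwise to power series in the deformation parameter. *)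

(* Defs.v *)
From HB Require Import structures.
From mathcomp Require Import all_boot all_order all_algebra generic_quotient ring_quotient.
From mathcomp Require Import boolp classical_sets functions cardinality fsbigop.

Set Implicit Arguments.
Unset Strict Implicit.
Unset Printing Implicit Defensive.

Import GRing.Theory.
Local Open Scope classical_set_scope.
Local Open Scope quotient_scope.
Local Open Scope ring_scope.

(* A decomposition of V as the direct sum of subgroups V_n (n : int), given by
   the projections hcomp n onto V_n. *)
Record grading (V : zmodType) := Grading {
  hcomp : int -> {additive V -> V};
  hcomp_hcomp : forall i j v,
    hcomp i (hcomp j v) = if i == j then hcomp j v else 0;
  hcomp_finite : forall v, finite_set [set i | hcomp i v != 0];
  hcomp_sum : forall v, v = \sum_(i \in [set: int]) hcomp i v
}.

Definition homog (V : zmodType) (g : grading V) (i : int) (v : V) : Prop :=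
  hcomp g i v = v.

(* (-1)^|v| v, extended additively to inhomogeneous v *)
Definition gsign (V : zmodType) (g : grading V) (v : V) : V :=
  \sum_(i \in [set: int]) (if odd `|i|%N then - hcomp g i v else hcomp g i v).

Lemma gsign_additive (V : zmodType) (g : grading V) : zmod_morphism (gsign g).
Proof.
move=> u v; pose P := [set i | hcomp g i u != 0] `|` [set i | hcomp g i v != 0].
have Pfin : finite_set P by rewrite finite_setU; split; exact: hcomp_finite.
pose s i w := if odd `|i|%N then - hcomp g i w else hcomp g i w.
have sE w : (forall i, ~ P i -> hcomp g i w = 0) ->
    gsign g w = \sum_(i \in P) s i w.
  move=> w0; apply/esym/fsbig_widen => // i [_ /w0 wi] /=.
  by rewrite /s wi oppr0 if_same.
have u0 i : ~ P i -> hcomp g i u = 0.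
  by move=> nP; apply: contra_notP nP => /eqP ?; left.
have v0 i : ~ P i -> hcomp g i v = 0.
  by move=> nP; apply: contra_notP nP => /eqP ?; right.
rewrite !sE // => [|i Pi]; last by rewrite raddfB u0 // v0 // subrr.
rewrite !fsbig_finite // -sumrB; apply: eq_bigr => i _; rewrite /s raddfB.
by case: ifP => // _; rewrite opprB opprK addrC.
Qed.

Definition is_even (V : zmodType) (g : grading V) (v : V) : Prop :=
  gsign g v = v.

Definition is_odd (V : zmodType) (g : grading V) (v : V) : Prop :=
  gsign g v = - v.

Definition odd_degree (V : zmodType) (g : grading V) (D : V -> V) : Prop :=
  exists d : int, odd `|d|%N /\ forall i v, homog g i v -> homog g (i + d) (D v).

(* (-1)^n for an integer n *)
Notation sgn n := ((-1) ^+ `|(n : int)|%N).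

Record gcomm_ring (R : nzRingType) (g : grading R) : Prop := GCommRing {
  homog1 : homog g 0 1;
  homogM : forall i j a b, homog g i a -> homog g j b -> homog g (i + j) (a * b);
  gcommM : forall i j a b, homog g i a -> homog g j b ->
    a * b = sgn (i * j) * (b * a)
}.

(* For a homogeneous, s a = (-1)^|a| a, so that this is
   (-1)^|a| (D (a b) - D a b - (-1)^|a| a D b).
   The same formula is used on A, on A[[t]] and on A[[eps]]. *)
Definition bracket (V : zmodType) (mul : V -> V -> V) (s D : V -> V) (a b : V) : V :=
  D (mul (s a) b) - mul (D (s a)) b - mul a (D b).

Lemma bracketBr (V : zmodType) (mul : V -> V -> V) (s D : V -> V) (a : V) :
    (forall u, zmod_morphism (mul u)) -> zmod_morphism D ->
  zmod_morphism (bracket mul s D a).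
Proof.
move=> mulB DB b c; rewrite /bracket !mulB !DB !mulB.
by rewrite !opprD !opprK [X in X + _ = _]addrACA [LHS]addrACA.
Qed.

(* Operators of odd degree are k-linear in the graded sense:
   D (c a) = (-1)^|c| c D a. *)
Definition odd_klinear (k : algType rat) (gk : grading k) (A : lalgType k)
    (D : A -> A) : Prop :=
  forall i (c : k) (a : A), homog gk i c -> D (c *: a) = (sgn i * c) *: D a.

Record dgbv (k : algType rat) (gk : grading k) := DGBV {
  carrier :> lalgType k;
  gr : grading carrier;
  gr_gcomm : gcomm_ring gr;
  gr_scale : forall i j (c : k) (a : carrier),
    homog gk i c -> homog gr j a -> homog gr (i + j) (c *: a);
  Delta : {additive carrier -> carrier};
  Delta_odd : odd_degree gr Delta;
  Delta_lin : odd_klinear gk Delta;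
  Delta2 : forall a, Delta (Delta a) = 0;
  Poisson : forall i j l a b c, homog gr i a -> homog gr j b -> homog gr l c ->
    let br := bracket *%R (gsign gr) Delta in
    br a (b * c) = br a b * c + sgn ((i - 1) * j) * (b * br a c);
  delta : {additive carrier -> carrier};
  delta_odd : odd_degree gr delta;
  delta_lin : odd_klinear gk delta;
  delta_der : forall i a b, homog gr i a ->
    delta (a * b) = delta a * b + sgn i * (a * delta b);
  delta2 : forall a, delta (delta a) = 0;
  delta_Delta : forall a, delta (Delta a) + Delta (delta a) = 0
}.

Arguments gr {k gk}.
Arguments Delta {k gk}.
Arguments delta {k gk}.

Definition ker (V W : zmodType) (D : V -> W) : set V := [set v | D v = 0].

Definition in_DGBVq (k : algType rat) (gk : grading k) (A : dgbv gk) : Prop :=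
  [/\ range (delta A \o Delta A) = range (Delta A \o delta A),
      range (Delta A \o delta A) = range (delta A) `&` ker (Delta A) &
      range (delta A) `&` ker (Delta A) = range (Delta A) `&` ker (delta A)].

(* Compatibility with the bracket follows, the bracket being defined from
   the product and Delta. *)
Record dgbv_hom (k : algType rat) (gk : grading k) (A1 A2 : dgbv gk) := DGBVHom {
  hom_fun :> {lrmorphism A1 -> A2};
  hom_gr : forall i a, hom_fun (hcomp (gr A1) i a) = hcomp (gr A2) i (hom_fun a);
  hom_delta : forall a, hom_fun (delta A1 a) = delta A2 (hom_fun a);
  hom_Delta : forall a, hom_fun (Delta A1 a) = Delta A2 (hom_fun a)
}.

Section Cohomology.
Variables (V : zmodType) (d : {additive V -> V}).

Definition cocycle_pred : {pred V} := fun v => d v == 0.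

Lemma cocycle_zmod : zmod_closed cocycle_pred.
Proof.
split=> [|u v]; rewrite /in_mem /= /cocycle_pred ?raddf0 // raddfB.
by move=> /eqP-> /eqP->; rewrite subr0.
Qed.

HB.instance Definition _ := GRing.isZmodClosed.Build V cocycle_pred cocycle_zmod.

Definition cocycle := {v : V | v \in cocycle_pred}.
HB.instance Definition _ := SubType.on cocycle.
HB.instance Definition _ := Choice.on cocycle.
HB.instance Definition _ := [SubChoice_isSubZmodule of cocycle by <:].

Definition coboundary_pred : {pred cocycle} := fun z => `[< range d (val z) >].

Lemma coboundary_zmod : zmod_closed coboundary_pred.
Proof.
split=> [|u v]; rewrite /in_mem /= /coboundary_pred.
  by apply/asboolP; exists 0 => //; rewrite !raddf0.
move=> /asboolP[a _ ua] /asboolP[b _ vb]; apply/asboolP.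
by exists (a - b) => //; rewrite !raddfB /= ua vb.
Qed.

HB.instance Definition _ :=
  GRing.isZmodClosed.Build cocycle coboundary_pred coboundary_zmod.

(* Ker d / (Ker d `&` Im d); this is Ker d / Im d when d \o d = 0. *)
Definition coh : zmodType := Quotient.quot coboundary_pred.

(* the class of v if v is a cocycle, 0 otherwise *)
Definition cls (v : V) : coh := \pi_coh (insubd (0 : cocycle) v).

Definition rep (c : coh) : V := val (repr c).

(* the product of classes induced by a product on V *)
Definition cmul (mul : V -> V -> V) (a b : coh) : coh := cls (mul (rep a) (rep b)).

End Cohomology.

Notation Hcoh A := (coh (delta A)).

Section Induced.
Variables (k : algType rat) (gk : grading k).

Definition hom_coh (A1 A2 : dgbv gk) (f : dgbv_hom A1 A2) (c : Hcoh A1) : Hcoh A2 :=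
  cls (delta A2) (f (rep c)).

Definition even_class (A : dgbv gk) (x : Hcoh A) : Prop :=
  exists a, [/\ is_even (gr A) a, delta A a = 0 & cls (delta A) a = x].

Definition odd_class (A : dgbv gk) (x : Hcoh A) : Prop :=
  exists a, [/\ is_odd (gr A) a, delta A a = 0 & cls (delta A) a = x].

End Induced.

(* M[[t]] is nat -> M, the n-th value being the coefficient of t^n. *)

Section Even.
Variables (k : algType rat) (gk : grading k) (A : dgbv gk).

Definition tmul (a b : nat -> A) : nat -> A :=
  fun n => \sum_(i < n.+1) a i * b (n - i)%N.

Definition tsign (a : nat -> A) : nat -> A := fun n => gsign (gr A) (a n).
Definition tDelta (a : nat -> A) : nat -> A := fun n => Delta A (a n).
Definition tdelta (a : nat -> A) : nat -> A := fun n => delta A (a n).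
Definition tbracket : (nat -> A) -> (nat -> A) -> nat -> A :=
  bracket tmul tsign tDelta.

(* x(t) is a normalized solution of the Maurer-Cartan equation with leading
   coefficient in the class x. It is not unique; twedge xt below is the
   deformed product for the chosen solution xt. *)
Record tMC (x : Hcoh A) (xt : nat -> A) : Prop := TMC {
  tMC0 : xt 0%N = 0;
  tMC_even : forall n, is_even (gr A) (xt n);
  tMC_eq : forall n, tdelta xt n + (2^-1 : rat)%:A *: tbracket xt xt n = 0;
  tMC1_delta : delta A (xt 1%N) = 0;
  tMC1_Delta : Delta A (xt 1%N) = 0;
  tMC1_cls : cls (delta A) (xt 1%N) = x;
  tMC_range : forall n, (1 < n)%N -> range (Delta A) (xt n)
}.

(* the differential delta_{x(t)} of A[[t]] *)
Definition tdelta_at (xt y : nat -> A) : nat -> A := tdelta y + tbracket xt y.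

Lemma tmul_additive (a : nat -> A) : zmod_morphism (tmul a).
Proof.
move=> b c; apply/funext => n; rewrite /tmul /= -[RHS]sumrB.
by apply: eq_bigr => i _; rewrite mulrBr.
Qed.

Lemma tdelta_at_additive xt : zmod_morphism (tdelta_at xt).
Proof.
have DB (D : {additive A -> A}) : zmod_morphism (fun (u : nat -> A) n => D (u n)).
  by move=> u v; apply/funext => n; rewrite raddfB.
have BB : zmod_morphism (tbracket xt) := bracketBr _ _ tmul_additive (DB (Delta A)).
move=> a b; rewrite /tdelta_at BB.
by rewrite /tdelta (DB (delta A)) addrACA -opprD.
Qed.

HB.instance Definition _ xt :=
  GRing.isZmodMorphism.Build (nat -> A) (nat -> A) (tdelta_at xt) (tdelta_at_additive xt).

(* y(t) = y_0 + y_1 t + ... extends a representative y_0 of h *)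
Definition is_tlift (xt : nat -> A) (h : Hcoh A) (y : nat -> A) : Prop :=
  [/\ delta A (y 0%N) = 0, Delta A (y 0%N) = 0, cls (delta A) (y 0%N) = h,
      tdelta_at xt y = 0 & forall n, (0 < n)%N -> range (Delta A) (y n)].

Definition tlift (xt : nat -> A) (h : Hcoh A) : nat -> A :=
  xget 0 [set y | is_tlift xt h y].

(* phi_{x(t)} : H(A)[[t]] -> H(A[[t]], delta_{x(t)}), which sends
   eta_0 + eta_1 t + ... to the class of sum_i tlift (eta_i) t^i *)
Definition tphi (xt : nat -> A) (eta : nat -> Hcoh A) : coh (tdelta_at xt) :=
  cls (tdelta_at xt) (fun n => \sum_(i < n.+1) tlift xt (eta i) (n - i)%N).

Definition tphi_inv (xt : nat -> A) (c : coh (tdelta_at xt)) : nat -> Hcoh A :=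
  xget 0 [set eta | tphi xt eta = c].

Definition twedge (xt : nat -> A) (a b : nat -> Hcoh A) : nat -> Hcoh A :=
  tphi_inv (cmul tmul (tphi xt a) (tphi xt b)).

Definition tconst (h : Hcoh A) : nat -> Hcoh A := fun n => if n == 0%N then h else 0.

End Even.

(* M[[eps]] is M * M, the pair (a_0, a_1) being a_0 + a_1 eps; eps is odd,
   eps^2 = 0 and eps a = (-1)^|a| a eps. *)

Section Odd.
Variables (k : algType rat) (gk : grading k) (A : dgbv gk).

Definition emul (a b : A * A) : A * A :=
  (a.1 * b.1, a.1 * b.2 + a.2 * gsign (gr A) b.1).

Definition esign (a : A * A) : A * A := (gsign (gr A) a.1, - gsign (gr A) a.2).
Definition eDelta (a : A * A) : A * A := (Delta A a.1, Delta A a.2).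
Definition edelta (a : A * A) : A * A := (delta A a.1, delta A a.2).
Definition ebracket : A * A -> A * A -> A * A := bracket emul esign eDelta.

(* x(eps) = x_1 eps, with x_1 in the class x; the Maurer-Cartan equation then
   holds automatically, because eps^2 = 0. *)
Record eMC (x : Hcoh A) (xe : A * A) : Prop := EMC {
  eMC0 : xe.1 = 0;
  eMC_odd : is_odd (gr A) xe.2;
  eMC_delta : delta A xe.2 = 0;
  eMC_Delta : Delta A xe.2 = 0;
  eMC_cls : cls (delta A) xe.2 = x
}.

(* the differential delta_{x(eps)} of A[[eps]] *)
Definition edelta_at (xe y : A * A) : A * A := edelta y + ebracket xe y.

Lemma emul_additive (a : A * A) : zmod_morphism (emul a).
Proof.
move=> b c; congr (_, _) => /=; first by rewrite mulrBr.
by rewrite gsign_additive !mulrBr opprD addrACA.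
Qed.

Lemma edelta_at_additive xe : zmod_morphism (edelta_at xe).
Proof.
have DB (D : {additive A -> A}) :
    zmod_morphism (fun u : A * A => (D u.1, D u.2) : A * A).
  by move=> u v; congr (_, _); rewrite raddfB.
have BB : zmod_morphism (ebracket xe) := bracketBr _ _ emul_additive (DB (Delta A)).
move=> a b; rewrite /edelta_at BB.
by rewrite /edelta (DB (delta A)) addrACA -opprD.
Qed.

HB.instance Definition _ xe :=
  GRing.isZmodMorphism.Build (A * A)%type (A * A)%type (edelta_at xe)
    (edelta_at_additive xe).

Definition is_elift (xe : A * A) (h : Hcoh A) (y : A * A) : Prop :=
  [/\ delta A y.1 = 0, Delta A y.1 = 0, cls (delta A) y.1 = h,
      edelta_at xe y = 0 & range (Delta A) y.2].

Definition elift (xe : A * A) (h : Hcoh A) : A * A :=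
  xget 0 [set y | is_elift xe h y].

(* phi_{x(eps)} sends eta_0 + eta_1 eps to the class of
   elift eta_0 + (elift eta_1) eps *)
Definition ephi (xe : A * A) (eta : Hcoh A * Hcoh A) : coh (edelta_at xe) :=
  let y := elift xe eta.1 in let z := elift xe eta.2 in
  cls (edelta_at xe) (y.1, y.2 + z.1).

Definition ephi_inv (xe : A * A) (c : coh (edelta_at xe)) : Hcoh A * Hcoh A :=
  xget 0 [set eta | ephi xe eta = c].

Definition ewedge (xe : A * A) (a b : Hcoh A * Hcoh A) : Hcoh A * Hcoh A :=
  ephi_inv (cmul emul (ephi xe a) (ephi xe b)).

Definition econst (h : Hcoh A) : Hcoh A * Hcoh A := (h, 0).

End Odd.

Section HomSeries.
Variables (k : algType rat) (gk : grading k) (A1 A2 : dgbv gk).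
Variable f : dgbv_hom A1 A2.

Definition hom_coht (eta : nat -> Hcoh A1) : nat -> Hcoh A2 := fun n => hom_coh f (eta n).

Definition hom_cohe (eta : Hcoh A1 * Hcoh A1) : Hcoh A2 * Hcoh A2 :=
  (hom_coh f eta.1, hom_coh f eta.2).

End HomSeries.

(* Main.v *)
From HB Require Import structures.
Require Import Defs.
From mathcomp Require Import all_boot all_order all_algebra generic_quotient ring_quotient zify.
From mathcomp Require Import boolp classical_sets functions cardinality fsbigop.

(** Two normalized Maurer-Cartan solutions with the same leading class, or more
    generally f(x(t)) and y(t) with y_1 cohomologous to f(x_1), are related by a
    gauge transformation whose generator g(t) has odd coefficients in
    Im Delta.  Let E = t d/dt.  Bracketing with g is an even derivation of the
    product that commutes with Delta, so the solution Phi of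

      E Phi = [g, Phi] + Phi E,   Phi = f at t = 0,

    is a homomorphism for the product, Delta and hence the bracket.  It
    satisfies Phi delta_x = delta_y Phi as soon as

      delta_y g + E y - Phi (E x) = 0,

    an equation that can be solved for g one coefficient at a time, because
    each obstruction is delta-closed and lies in Im Delta.  Since bracketing
    with g sends Ker Delta to Im Delta, Phi sends the distinguished lift of a
    class to a distinguished lift of its image, so that in cohomology
    Phi is f_* under the identifications phi_x and phi_y.  In the odd case
    eps^2 = 0, and Phi = f + [w eps, f] with delta w = f(x) - y. *)

Set Implicit Arguments.
Unset Strict Implicit.
Unset Printing Implicit Defensive.
Import GRing.Theory.
Local Open Scope classical_set_scope.
Local Open Scope quotient_scope.
Local Open Scope ring_scope.

(** * A decision procedure for identities in abelian groups *)

(** The two solutions are chosen independently, and f need be neither injective nor surjective, so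
    the comparison has to take place in the target, after f. A differential equation in E is used
    rather than an exponential: the unknown g then enters linearly at each new order, no
    Baker-Campbell-Hausdorff series appears, and coefficient n of Phi comes from a division by n,
    which the rational scalars permit. The equation for g results from applying E to Phi delta_x -
    delta_y Phi: this difference satisfies a linear equation whose source is the bracket with the
    left-hand side of the equation for g. The obstacle is that an obstruction is closed only if Phi
    already intertwines the differentials, which is known only below the current order. The
    intertwining is needed only on E x, however, which has no constant term, and this gains the
    missing order. *)

Inductive zterm :=
  | ZVar of nat | ZZero | ZAdd of zterm & zterm | ZOpp of zterm | ZMuln of zterm & nat.

Fixpoint zcoef (t : zterm) (i : nat) : int :=
  match t with
  | ZVar j => (i == j : nat)
  | ZZero => 0
  | ZAdd t1 t2 => zcoef t1 i + zcoef t2 i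
  | ZOpp t1 => - zcoef t1 i
  | ZMuln t1 n => zcoef t1 i * n
  end.

Fixpoint zval (V : zmodType) (s : seq V) (t : zterm) : V :=
  match t with
  | ZVar j => nth 0 s j
  | ZZero => 0
  | ZAdd t1 t2 => zval s t1 + zval s t2
  | ZOpp t1 => - zval s t1
  | ZMuln t1 n => zval s t1 *+ n
  end.

Lemma zval_sum (V : zmodType) (s : seq V) (t : zterm) :
  zval s t = \sum_(i < size s) nth 0 s i *~ zcoef t i.
Proof.
elim: t => [j||t1 IH1 t2 IH2|t1 IH1|t1 IH1 n] /=.
- case: (ltnP j (size s)) => js.
    rewrite (bigD1 (Ordinal js)) //= eqxx big1 ?addr0 // => i.
    by rewrite -val_eqE /= => /negPf->.
  rewrite nth_default // big1 // => i _; case: eqP => // ij.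
  by have := ltn_ord i; rewrite ij ltnNge js.
- by rewrite big1.
- by rewrite IH1 IH2 -big_split; apply: eq_bigr => i _; rewrite mulrzDr.
- by rewrite IH1 -sumrN; apply: eq_bigr => i _; rewrite mulrNz.
- by rewrite IH1 -sumrMnl; apply: eq_bigr => i _; rewrite mulrzA pmulrn.
Qed.

(** Soundness of the reflection: integer coefficients are compared by computation, and only for
    indices below the length of the environment, since any other variable evaluates to 0. *)
Lemma zval_eq (V : zmodType) (s : seq V) (t1 t2 : zterm) :
    all (fun i => zcoef t1 i == zcoef t2 i) (iota 0 (size s)) ->
  zval s t1 = zval s t2.
Proof.
move=> /allP t12; rewrite !zval_sum; apply: eq_bigr => i _.
by rewrite (eqP (t12 i _)) // mem_iota add0n ltn_ord.
Qed.

Ltac zmem x s :=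
  lazymatch s with
  | nil => false
  | cons ?y ?s' =>
    match goal with
    | _ => let _ := match goal with _ => unify x y end in true
    | _ => zmem x s'
    end
  end.

(* Atoms are compared up to conversion, because different paths in the
   hierarchy of structures lead to different terms. *)
Ltac zindex x s :=
  lazymatch s with
  | cons ?y ?s' =>
    match goal with
    | _ => let _ := match goal with _ => unify x y end in constr:(0%N)
    | _ => let i := zindex x s' in constr:(S i)
    end
  end.

Ltac zatoms t s :=
  lazymatch t with
  | ?a + ?b => let s' := zatoms b s in zatoms a s'
  | - ?a => zatoms a s
  | ?a *+ _ => zatoms a s
  | 0 => s
  | _ => lazymatch zmem t s with true => s | false => constr:(cons t s) end
  end.

Ltac zreify t s :=
  lazymatch t with
  | ?a + ?b => let a' := zreify a s in let b' := zreify b s in constr:(ZAdd a' b')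
  | - ?a => let a' := zreify a s in constr:(ZOpp a')
  | ?a *+ ?n => let a' := zreify a s in constr:(ZMuln a' n)
  | 0 => constr:(ZZero)
  | _ => let i := zindex t s in constr:(ZVar i)
  end.

Ltac abelian :=
  lazymatch goal with
  | |- @eq ?T ?a ?b =>
    let s0 := constr:(@nil T) in
    let s1 := zatoms b s0 in
    let s := zatoms a s1 in
    let ta := zreify a s in
    let tb := zreify b s in
    apply: (@zval_eq _ s ta tb); vm_compute; reflexivity
  end.

(** * Parity in graded groups and DGBV algebras *)

Lemma odd_abszD (i j : int) : odd `|(i + j)%R|%N = odd `|i|%N (+) odd `|j|%N.
Proof. lia. Qed.

Section Graded.
Variables (V : zmodType) (g : grading V).

HB.instance Definition _ := GRing.isZmodMorphism.Build V V (gsign g) (gsign_additive g).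

(** Every element is a finite sum of homogeneous components, so an additive identity need only be
    checked on those. *)
Lemma homog_ind (P : V -> Prop) : P 0 -> (forall u v, P u -> P v -> P (u + v)) ->
  (forall i v, homog g i v -> P v) -> forall v, P v.
Proof.
move=> P0 PD Ph v; rewrite (hcomp_sum g v) fsbig_supp.
set D := (X in \sum_(i \in X) _).
rewrite fsbig_finite; last first.
  by apply: (sub_finite_set _ (hcomp_finite g v)) => i [_ /= iv]; apply/eqP.
by apply: big_ind => // i _; apply: (Ph i); rewrite /homog hcomp_hcomp eqxx.
Qed.

Lemma gsign_homog i v : homog g i v -> gsign g v = if odd `|i|%N then - v else v.
Proof.
move=> hv; rewrite /gsign -[in RHS]hv.
pose s j := if odd `|j|%N then - hcomp g j v else hcomp g j v.
rewrite -[RHS]/(s i) -(fsbig_set1 +%R i s); apply/esym/fsbig_widen => // j [_ /= ji]; rewrite /s /=.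
have -> : hcomp g j v = 0 by rewrite -[v]hv hcomp_hcomp; case: eqP.
by rewrite oppr0 if_same.
Qed.

Lemma gsignK v : gsign g (gsign g v) = v.
Proof.
elim/homog_ind: v => [|u v IHu IHv|i v hv]; first by rewrite !raddf0.
  by rewrite !raddfD /= IHu IHv.
rewrite (gsign_homog hv); case: ifP => oi; last by rewrite (gsign_homog hv) oi.
by rewrite raddfN /= (gsign_homog hv) oi opprK.
Qed.

Lemma gsign_odd_degree (D : {additive V -> V}) : odd_degree g D ->
  forall v, gsign g (D v) = - D (gsign g v).
Proof.
move=> [d [dodd Dd]] v; elim/homog_ind: v => [|u v IHu IHv|i v hv].
- by rewrite !raddf0.
- by rewrite !raddfD /= IHu IHv.
rewrite (gsign_homog hv) (gsign_homog (Dd _ _ hv)).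
rewrite odd_abszD dodd addbT.
by case: (odd _); rewrite ?raddfN ?opprK.
Qed.

(** [v + gsign g v] is twice the even part of [v]: odd components cancel and even ones double, so a
    mere abelian group suffices, without division by 2. *)
Lemma even_part_ind (P : V -> Prop) : P 0 -> (forall u v, P u -> P v -> P (u + v)) ->
    (forall i v, homog g i v -> ~~ odd `|i|%N -> P v) ->
  forall v, P (v + gsign g v).
Proof.
move=> P0 PD Ph; elim/homog_ind => [|u v Pu Pv|i v hv].
- by rewrite raddf0 addr0.
- by rewrite raddfD addrACA; apply: PD.
rewrite (gsign_homog hv); case: (boolP (odd _)) => oi; first by rewrite subrr.
by apply: PD; apply: (Ph i).
Qed.

Lemma odd_part_ind (P : V -> Prop) : P 0 -> (forall u v, P u -> P v -> P (u + v)) ->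
    (forall i v, homog g i v -> odd `|i|%N -> P v) ->
  forall v, P (v - gsign g v).
Proof.
move=> P0 PD Ph; elim/homog_ind => [|u v Pu Pv|i v hv].
- by rewrite raddf0 subr0.
- by rewrite raddfD opprD addrACA; apply: PD.
rewrite (gsign_homog hv); case: (boolP (odd _)) => oi; last by rewrite subrr.
by rewrite opprK; apply: PD; apply: (Ph i).
Qed.

End Graded.

(** * Brackets and odd derivations in algebras with a sign operator *)

Section SuperAlgebra.
Variables (V : zmodType) (mul : V -> V -> V) (s D : {additive V -> V}).

(** This covers [delta], the bracket with an even [Delta]-closed element, and their sum, the twisted
    differential. *)
Definition odd_derivation (d : V -> V) : Prop :=
  [/\ forall a b, d (mul a b) = mul (d a) b + mul (s a) (d b),
      forall a, d (D a) = - D (d a) & forall a, s (d a) = - d (s a)].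

(* The parts of the structure of a GBV algebra that do not involve the
   Poisson identity. *)
Record super_alg : Prop := SuperAlg {
  sup_mulr_morph : forall a, zmod_morphism (mul a);
  sup_mull_morph : forall b, zmod_morphism (mul^~ b);
  sup_signM : forall a b, s (mul a b) = mul (s a) (s b);
  sup_signK : forall a, s (s a) = a;
  sup_signD : forall a, s (D a) = - D (s a);
  sup_DD : forall a, D (D a) = 0
}.

Hypothesis SA : super_alg.
Notation br := (bracket mul s D).

Lemma sup_mulBr a b c : mul a (b - c) = mul a b - mul a c.
Proof. exact: (sup_mulr_morph SA). Qed.
Lemma sup_mulBl a b c : mul (b - c) a = mul b a - mul c a.
Proof. exact: (sup_mull_morph SA). Qed.
Lemma sup_mul0r a : mul 0 a = 0.
Proof. by rewrite -(subrr 0) sup_mulBl !subrr. Qed.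
Lemma sup_mulr0 a : mul a 0 = 0.
Proof. by rewrite -(subrr 0) sup_mulBr !subrr. Qed.
Lemma sup_mulNr a b : mul (- a) b = - mul a b.
Proof. by rewrite -(sub0r a) sup_mulBl sup_mul0r sub0r. Qed.
Lemma sup_mulrN a b : mul a (- b) = - mul a b.
Proof. by rewrite -(sub0r b) sup_mulBr sup_mulr0 sub0r. Qed.
Lemma sup_mulDr a b c : mul a (b + c) = mul a b + mul a c.
Proof. by rewrite -{1}(opprK c) sup_mulBr sup_mulrN opprK. Qed.
Lemma sup_mulDl a b c : mul (b + c) a = mul b a + mul c a.
Proof. by rewrite -{1}(opprK c) sup_mulBl sup_mulNr opprK. Qed.

Lemma bracketBl b : zmod_morphism (br^~ b).
Proof.
move=> u v; rewrite /bracket !(raddfB, sup_mulBl) /=; abelian.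
Qed.

Lemma bracket0l b : br 0 b = 0.
Proof. by have := bracketBl b 0 0; rewrite !subrr. Qed.

Lemma bracketDl a b c : br (a + b) c = br a c + br b c.
Proof. by rewrite /bracket !(raddfD, sup_mulDl) /=; abelian. Qed.

Lemma bracketDr a b c : br a (b + c) = br a b + br a c.
Proof. by rewrite /bracket !(raddfD, sup_mulDr) /=; abelian. Qed.

Lemma bracketNr a b : br a (- b) = - br a b.
Proof. by rewrite /bracket !(raddfN, sup_mulrN) /=; abelian. Qed.

Lemma br_even x b : s x = x -> D x = 0 -> br x b = D (mul x b) - mul x (D b).
Proof. by move=> sx Dx; rewrite /bracket sx Dx sup_mul0r subr0. Qed.

Lemma br_odd g b : s g = - g -> D g = 0 -> br g b = - D (mul g b) - mul g (D b).
Proof.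
by move=> sg Dg; rewrite /bracket sg !raddfN Dg oppr0 sup_mul0r sup_mulNr raddfN subr0.
Qed.

(** On [Ker D] the bracket is [D]-exact. This is what puts obstructions and corrections into the
    image of [D]. *)
Lemma br_ker a b : D a = 0 -> D b = 0 -> br a b = D (mul (s a) b).
Proof.
move=> Da Db; have /eqP := sup_signD SA a; rewrite Da raddf0 eq_sym oppr_eq0 => /eqP Dsa.
by rewrite /bracket Db sup_mulr0 Dsa sup_mul0r !subr0.
Qed.

Lemma br_evenD x b : s x = x -> D x = 0 -> br x (D b) = - D (br x b).
Proof.
move=> sx Dx; rewrite !br_even // (sup_DD SA) sup_mulr0 raddfB /= (sup_DD SA).
abelian.
Qed.

Lemma br_oddD g b : s g = - g -> D g = 0 -> br g (D b) = D (br g b).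
Proof.
move=> sg Dg; rewrite !br_odd // (sup_DD SA) sup_mulr0 raddfB /= raddfN /= (sup_DD SA).
abelian.
Qed.

Lemma br_odd_derivation x : s x = x -> D x = 0 ->
    (forall a b, br x (mul a b) = mul (br x a) b + mul (s a) (br x b)) ->
  odd_derivation (br x).
Proof.
move=> sx Dx bM; split=> // a; first exact: br_evenD.
rewrite !br_even // raddfB /= (sup_signM SA) !(sup_signD SA) (sup_signM SA) sx sup_mulrN.
abelian.
Qed.

Lemma sign_br_odd g b : s g = - g -> D g = 0 -> s (br g b) = br g (s b).
Proof.
move=> sg Dg; rewrite !br_odd // raddfB /= raddfN /= (sup_signM SA) !(sup_signD SA).
by rewrite (sup_signM SA) sg sup_mulrN !sup_mulNr raddfN; abelian.
Qed.

Lemma odd_derivationD (d1 d2 : V -> V) :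
  odd_derivation d1 -> odd_derivation d2 -> odd_derivation (fun v => d1 v + d2 v).
Proof.
move=> [M1 D1 s1] [M2 D2 s2]; split=> [a b|a|a].
- by rewrite M1 M2 sup_mulDl sup_mulDr; abelian.
- by rewrite D1 D2 raddfD /=; abelian.
- by rewrite raddfD /= s1 s2; abelian.
Qed.

Section Derivation.
Variable d : {additive V -> V}.
Hypothesis dP : odd_derivation d.

Lemma der_ker a : D a = 0 -> D (d a) = 0.
Proof. by case: dP => _ dD _ Da; apply/eqP; rewrite -oppr_eq0 -dD Da raddf0. Qed.

Lemma der_odd x : s x = x -> s (d x) = - d x.
Proof. by case: dP => _ _ ds sx; rewrite ds sx. Qed.

Lemma der_even g : s g = - g -> s (d g) = d g.
Proof. by case: dP => _ _ ds sg; rewrite ds sg raddfN opprK. Qed.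

(** For an even [D]-closed [x] the bracket is [D (x b) - x (D b)], so a derivation of the product
    that anticommutes with [D] also differentiates the bracket. *)
Lemma der_br_even x b : s x = x -> D x = 0 -> d (br x b) = br (d x) b - br x (d b).
Proof.
move=> sx Dx; have [dM dD ds] := dP.
rewrite !(br_even _ sx Dx) (br_odd _ (der_odd sx) (der_ker Dx)) raddfB /= dD !dM dD sx raddfD.
by rewrite /= sup_mulrN; abelian.
Qed.

Lemma der_br_odd g b : s g = - g -> D g = 0 -> d (br g b) = br (d g) b + br g (d b).
Proof.
move=> sg Dg; have [dM dD ds] := dP.
rewrite !(br_odd _ sg Dg) (br_even _ (der_even sg) (der_ker Dg)) raddfB /= raddfN /= dD !dM dD.
by rewrite sg raddfD /= !sup_mulNr sup_mulrN raddfN /=; abelian.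
Qed.

End Derivation.

(* Both identities follow by applying [der_br_even] to the odd derivation
   [br x] itself. *)
Lemma br_br_even x b : s x = x -> D x = 0 -> odd_derivation (br x) ->
  br x (br x b) *+ 2 = br (br x x) b.
Proof.
move=> sx Dx bx.
pose L : {additive V -> V} := HB.pack (br x)
  (GRing.isZmodMorphism.Build V V (br x) (bracketBr _ _ (sup_mulr_morph SA) (raddfB D))).
by rewrite mulr2n -{1}[br x _]/(L _) (@der_br_even L) //=; abelian.
Qed.

Lemma br_br_br x : s x = x -> D x = 0 -> odd_derivation (br x) ->
  (forall y, mul x y = mul y x) -> br x (br x x) *+ 3 = 0.
Proof.
move=> sx Dx bx xC; have [_ _ bxs] := bx; have [sbx Dbx] : s (br x x) = - br x x /\ D (br x x) = 0.
  by rewrite bxs sx; split=> //; rewrite br_ker ?(sup_DD SA).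
have e : br (br x x) x = - br x (br x x).
  by rewrite br_ker // [in RHS]br_ker // sbx sx sup_mulNr raddfN /= xC.
rewrite mulrS br_br_even // e; abelian.
Qed.

End SuperAlgebra.

(** * DGBV algebras on inhomogeneous elements, and the [delta]-[Delta] lemma *)

Section Algebra.
Variables (k : algType rat) (gk : grading k) (A : dgbv gk).
Implicit Types a b c u v : A.
Notation s := (gsign (gr A)).
Notation D := (Delta A).
Notation d := (delta A).
Notation br := (bracket *%R s D).

(** The rational number acts through its image in [k], the carrier being given as a module over [k]
    only. *)
Definition qdiv (n : nat) (v : A) : A := (n%:R^-1 : rat)%:A *: v.

Lemma qdivK n v : (0 < n)%N -> qdiv n v *+ n = v.
Proof.
case: n => // n _; rewrite /qdiv scalerMnl scalerMnl -mulr_natr mulVf.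
  by rewrite !scale1r.
by rewrite Num.Theory.pnatr_eq0.
Qed.

Lemma mulrn_eq0_rat n v : (0 < n)%N -> v *+ n = 0 -> v = 0.
Proof.
move=> n0 vn; rewrite -(qdivK v n0) /qdiv scalerMnr vn scaler0 //.
Qed.

Lemma mulrn_inj_rat n u v : (0 < n)%N -> u *+ n = v *+ n -> u = v.
Proof.
move=> n0 /eqP; rewrite -subr_eq0 -mulrnBl => /eqP /(mulrn_eq0_rat n0) /eqP.
by rewrite subr_eq0 => /eqP.
Qed.

Lemma even_halves v : s v = v -> exists w, v = w + s w.
Proof.
move=> sv; exists (qdiv 2 v).
have -> : s (qdiv 2 v) = qdiv 2 v.
  by apply: (@mulrn_inj_rat 2) => //; rewrite -raddfMn !qdivK.
by rewrite -mulr2n qdivK.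
Qed.

Lemma odd_halves v : s v = - v -> exists w, v = w - s w.
Proof.
move=> sv; exists (qdiv 2 v).
have -> : s (qdiv 2 v) = - qdiv 2 v.
  by apply: (@mulrn_inj_rat 2) => //; rewrite -raddfMn mulNrn !qdivK.
by rewrite opprK -mulr2n qdivK.
Qed.

Lemma even_ind (P : A -> Prop) : P 0 -> (forall u v, P u -> P v -> P (u + v)) ->
    (forall i v, homog (gr A) i v -> ~~ odd `|i|%N -> P v) ->
  forall v, s v = v -> P v.
Proof. by move=> P0 PD Ph v /even_halves[w ->]; apply: even_part_ind. Qed.

Lemma odd_ind (P : A -> Prop) : P 0 -> (forall u v, P u -> P v -> P (u + v)) ->
    (forall i v, homog (gr A) i v -> odd `|i|%N -> P v) ->
  forall v, s v = - v -> P v.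
Proof. by move=> P0 PD Ph v /odd_halves[w ->]; apply: odd_part_ind. Qed.

Lemma sgn_odd (R : pzRingType) (i : int) : sgn i = (if odd `|i|%N then -1 else 1) :> R.
Proof. by rewrite -signr_odd; case: odd. Qed.

Lemma gsignM a b : s (a * b) = s a * s b.
Proof.
elim/(@homog_ind _ (gr A)): a => [|u v IHu IHv|i a ha].
- by rewrite raddf0 !mul0r raddf0.
- by rewrite mulrDl !raddfD /= IHu IHv mulrDl.
elim/(@homog_ind _ (gr A)): b => [|u v IHu IHv|j b hb].
- by rewrite raddf0 !mulr0 raddf0.
- by rewrite mulrDr !raddfD /= IHu IHv mulrDr.
rewrite (gsign_homog ha) (gsign_homog hb) (gsign_homog (homogM (gr_gcomm A) ha hb)).
by rewrite odd_abszD; do 2!case: odd; rewrite /= ?mulNr ?mulrN ?opprK.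
Qed.

Lemma delta_derE a b : d (a * b) = d a * b + s a * d b.
Proof.
elim/(@homog_ind _ (gr A)): a => [|u v IHu IHv|i a ha].
- by rewrite !raddf0 !mul0r raddf0 addr0.
- by rewrite mulrDl !raddfD /= IHu IHv !mulrDl; abelian.
rewrite (delta_der b ha) (gsign_homog ha) sgn_odd.
by case: odd; rewrite ?mulN1r ?mul1r ?mulNr.
Qed.

Lemma dgbv_super : super_alg *%R (gsign (gr A)) (Delta A).
Proof.
split.
- by move=> a b c; rewrite mulrBr.
- by move=> a b c /=; rewrite mulrBl.
- exact: gsignM.
- exact: gsignK.
- exact: gsign_odd_degree (Delta_odd A).
- exact: Delta2.
Qed.

Lemma delta_odd_derivation : odd_derivation *%R (gsign (gr A)) (Delta A) (delta A).
Proof.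
split.
- exact: delta_derE.
- by move=> a; apply/eqP; rewrite -subr_eq0 opprK delta_Delta.
- exact: gsign_odd_degree (delta_odd A).
Qed.

Lemma even_commr a b : s a = a -> a * b = b * a.
Proof.
elim/even_ind => [|u v IHu IHv|i {}a ha ei]; first by rewrite mul0r mulr0.
  by rewrite mulrDl mulrDr IHu IHv.
elim/(@homog_ind _ (gr A)): b => [|u v IHu IHv|j b hb]; first by rewrite mul0r mulr0.
  by rewrite mulrDl mulrDr IHu IHv.
by rewrite (gcommM (gr_gcomm A) ha hb) sgn_odd abszM oddM (negPf ei) mul1r.
Qed.

(** The sign [(-1)^((|a|-1)|b|)] is trivial for odd [a] and is the sign operator on [b] for even
    [a]; in this form [b] and [c] may be inhomogeneous. *)
Lemma br_mul_homog i a b c : homog (gr A) i a ->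
  br a (b * c) = br a b * c + (if odd `|i|%N then b else s b) * br a c.
Proof.
move=> ha; have brD (u v w : A) : br u (v + w) = br u v + br u w := bracketDr dgbv_super u v w.
have br0 (u : A) : br u 0 = 0 by rewrite /bracket !(mulr0, raddf0, addr0, subr0).
elim/(@homog_ind _ (gr A)): b => [|u v IHu IHv|j b hb].
- by rewrite raddf0 mul0r br0 if_same !mul0r addr0.
- rewrite mulrDl !brD raddfD /= IHu IHv.
  by case: (odd _); rewrite !mulrDl; abelian.
elim/(@homog_ind _ (gr A)): c => [|u v IHu IHv|l c hc].
- by rewrite mulr0 br0 !mulr0 addr0.
- rewrite mulrDr !brD IHu IHv.
  by case: (odd _); rewrite !mulrDr; abelian.
rewrite (Poisson ha hb hc) (gsign_homog hb) sgn_odd abszM oddM odd_abszD /= addbT.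
by case: (odd `|i|%N); case: (odd `|j|%N) => /=; rewrite ?mulN1r ?mul1r ?mulNr.
Qed.

Lemma even_Poisson a b c : s a = a -> br a (b * c) = br a b * c + s b * br a c.
Proof.
have brD (u v w : A) : br (u + v) w = br u w + br v w := bracketDl dgbv_super u v w.
have br0 (w : A) : br 0 w = 0 by rewrite /bracket !(mul0r, raddf0, addr0, subr0).
elim/even_ind => [|u v IHu IHv|i {}a ha ei]; first by rewrite !br0 mul0r mulr0 addr0.
  by rewrite !brD IHu IHv (mulrDl (br u b)) (mulrDr (s b) (br u c)); abelian.
by rewrite (br_mul_homog _ _ ha) (negPf ei).
Qed.

Lemma odd_Poisson a b c : s a = - a -> br a (b * c) = br a b * c + b * br a c.
Proof.
have brD (u v w : A) : br (u + v) w = br u w + br v w := bracketDl dgbv_super u v w.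
have br0 (w : A) : br 0 w = 0 by rewrite /bracket !(mul0r, raddf0, addr0, subr0).
elim/odd_ind => [|u v IHu IHv|i {}a ha ei]; first by rewrite !br0 mul0r mulr0 addr0.
  by rewrite !brD IHu IHv (mulrDl (br u b)) (mulrDr b (br u c)); abelian.
by rewrite (br_mul_homog _ _ ha) ei.
Qed.

Hypothesis Aq : in_DGBVq A.

(** This and the next lemma are the two halves of the analogue of the [ddbar]-lemma of Kaehler
    geometry; they are what membership in the category provides. *)
Lemma exact_dD_of_d v : range d v -> D v = 0 -> exists u, v = d (D u).
Proof.
case: Aq => q1 q2 q3 dv Dv; have : (range d `&` ker D) v by [].
by rewrite -q2 -q1 => -[u _ <-]; exists u.
Qed.

Lemma exact_dD_of_D v : range D v -> d v = 0 -> exists u, v = d (D u).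
Proof.
case: Aq => q1 q2 q3 dv Dv; have : (range D `&` ker d) v by [].
by rewrite -q3 -q2 -q1 => -[u _ <-]; exists u.
Qed.

Lemma sign_dD u : s (d (D u)) = d (D (s u)).
Proof.
have [_ _ ds] := delta_odd_derivation; rewrite ds (sup_signD dgbv_super) /=.
by rewrite raddfN opprK.
Qed.

(** [d D] preserves parity, so [u] can be replaced by its even part [e]; then [D e] is odd. *)
Lemma even_dD v u : s v = v -> v = d (D u) ->
  exists w, [/\ s w = - w, range D w & v = d w].
Proof.
move=> sv vu; pose e := qdiv 2 (u + s u).
have se : s e = e.
  by apply: (@mulrn_inj_rat 2) => //; rewrite -raddfMn !qdivK // raddfD /= gsignK addrC.
exists (D e); split; first by rewrite (sup_signD dgbv_super) /= se.
  by exists e.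
apply: (@mulrn_inj_rat 2) => //; have -> : d (D e) *+ 2 = d (D (e *+ 2)) by rewrite !raddfMn.
rewrite qdivK // !raddfD /= -vu mulr2n.
by rewrite -sign_dD -vu sv.
Qed.

Lemma odd_dD v u : s v = - v -> v = d (D u) ->
  exists w, [/\ s w = w, range D w & v = d w].
Proof.
move=> sv vu; pose e := qdiv 2 (u - s u).
have se : s e = - e.
  apply: (@mulrn_inj_rat 2) => //; rewrite -raddfMn mulNrn !qdivK // raddfB /= gsignK.
  by rewrite opprB.
exists (D e); split; first by rewrite (sup_signD dgbv_super) /= se raddfN opprK.
  by exists e.
apply: (@mulrn_inj_rat 2) => //; have -> : d (D e) *+ 2 = d (D (e *+ 2)) by rewrite !raddfMn.
rewrite qdivK // !raddfB /= -vu mulr2n.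
by rewrite -sign_dD -vu sv opprK.
Qed.

(* Surjectivity of H(Ker Delta, delta) -> H(A, delta). *)
Lemma ker_rep v : d v = 0 -> exists u, D (v - d u) = 0.
Proof.
move=> dv; have [_ dD _] := delta_odd_derivation.
have [] := @exact_dD_of_D (D v); first by exists v.
  by rewrite dD dv raddf0 oppr0.
(* [D v = d (D u) = - D (d u)], so [v + d u] lies in [Ker D]. *)
by move=> u Dv; exists (- u); rewrite raddfN /= opprK raddfD /= Dv dD addrC subrr.
Qed.

End Algebra.

(** * Sums over triangles and convolution of sequences *)

Lemma big_triangle (V : zmodType) (n : nat) (F : nat -> nat -> V) :
  \sum_(i < n.+1) \sum_(j < (n - i).+1) F i j =
  \sum_(i < n.+1) \sum_(j < n.+1 | (i + j <= n)%N) F i j.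
Proof.
apply: eq_bigr => i _; rewrite (big_ord_widen n.+1 (F i)) ?ltnS ?leq_subr //.
by apply: eq_bigl => j; have := ltn_ord i; lia.
Qed.

Lemma triangle_swap (V : zmodType) (n : nat) (F : nat -> nat -> V) :
  \sum_(i < n.+1) \sum_(j < (n - i).+1) F i j =
  \sum_(j < n.+1) \sum_(i < (n - j).+1) F i j.
Proof.
rewrite big_triangle (big_triangle n (fun j i => F i j)) (exchange_big_dep xpredT) //=.
by apply: eq_bigr => j _; apply: eq_bigl => i; rewrite addnC.
Qed.

(** Both sides run over the triples of indices with sum [n]; this is the associativity of
    convolution. *)
Lemma triangle_assoc (V : zmodType) (n : nat) (F : nat -> nat -> nat -> V) :
  \sum_(m < n.+1) \sum_(i < m.+1) F i (m - i)%N (n - m)%N =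
  \sum_(i < n.+1) \sum_(j < (n - i).+1) F i j (n - i - j)%N.
Proof.
have -> : \sum_(m < n.+1) \sum_(i < m.+1) F i (m - i)%N (n - m)%N =
    \sum_(m < n.+1) \sum_(i < n.+1 | (i <= m)%N) F i (m - i)%N (n - m)%N.
  apply: eq_bigr => m _.
  by rewrite (big_ord_widen n.+1 (fun i => F i (m - i)%N (n - m)%N)).
rewrite (exchange_big_dep xpredT) //=; apply: eq_bigr => i _.
rewrite -(big_mkord (fun m => (i <= m)%N) (fun m => F i (m - i)%N (n - m)%N)).
rewrite -(big_mkord xpredT (fun j => F i j (n - i - j)%N)).
have -> : (n - i).+1 = (n.+1 - i)%N by have := ltn_ord i; lia.
rewrite -(big_nat_widenl i 0 n.+1 xpredT) // -{1}(add0n (nat_of_ord i)) big_addn.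
by apply: eq_bigr => j _; rewrite addnK addnC subnDA.
Qed.

Lemma zmod_morph_sum (U V : zmodType) (f : U -> V) (n : nat) (F : 'I_n -> U) :
  zmod_morphism f -> f (\sum_(i < n) F i) = \sum_(i < n) f (F i).
Proof.
move=> fB; pose g : {additive U -> V} := HB.pack f (GRing.isZmodMorphism.Build U V f fB).
exact: (raddf_sum g).
Qed.

Lemma zmod_morph_muln (U V : zmodType) (f : U -> V) (n : nat) (u : U) :
  zmod_morphism f -> f (u *+ n) = f u *+ n.
Proof.
move=> fB; pose g : {additive U -> V} := HB.pack f (GRing.isZmodMorphism.Build U V f fB).
exact: (raddfMn g).
Qed.

(** [F] is arbitrary so that the product, the bracket and their composites are all convolutions;
    identities between coefficients then pass to series term by term. *)
Definition conv (T1 T2 : Type) (V : zmodType) (F : T1 -> T2 -> V)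
    (a : nat -> T1) (b : nat -> T2) : nat -> V :=
  fun n => \sum_(i < n.+1) F (a i) (b (n - i)%N).

Section Conv.
Variables (T1 T2 T3 : Type) (V W : zmodType).

Definition conv3 (F : T1 -> T2 -> T3 -> V)
    (a : nat -> T1) (b : nat -> T2) (c : nat -> T3) : nat -> V :=
  fun n => \sum_(i < n.+1) \sum_(j < (n - i).+1) F (a i) (b j) (c (n - i - j)%N).

Lemma conv_conv_r (F : T1 -> W -> V) (G : T2 -> T3 -> W) a b c :
    (forall u, zmod_morphism (F u)) ->
  conv F a (conv G b c) = conv3 (fun u v w => F u (G v w)) a b c.
Proof.
move=> FB; apply/funext => n; apply: eq_bigr => i _.
by rewrite (zmod_morph_sum _ (FB _)).
Qed.

Lemma conv_conv_l (F : W -> T3 -> V) (G : T1 -> T2 -> W) a b c :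
    (forall w, zmod_morphism (F^~ w)) ->
  conv F (conv G a b) c = conv3 (fun u v w => F (G u v) w) a b c.
Proof.
move=> FB; apply/funext => n.
rewrite -[RHS](triangle_assoc n (fun i j l => F (G (a i) (b j)) (c l))).
apply: eq_bigr => m _.
by rewrite (zmod_morph_sum _ (FB _)).
Qed.

End Conv.

Lemma conv3_swap (T1 T2 T3 : Type) (V : zmodType) (F : T1 -> T2 -> T3 -> V) a b c :
  conv3 F a b c = conv3 (fun v u w => F u v w) b a c.
Proof.
apply/funext => n; rewrite /conv3.
rewrite (triangle_swap n (fun i j => F (a i) (b j) (c (n - i - j)%N))).
by apply: eq_bigr => j _; apply: eq_bigr => i _; rewrite subnAC.
Qed.

Lemma conv_sym (T1 T2 : Type) (V : zmodType) (F : T1 -> T2 -> V) a b :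
  conv F a b = conv (fun u v => F v u) b a.
Proof.
apply/funext => n; rewrite /conv (reindex_inj rev_ord_inj) /=.
by apply: eq_bigr => i _; rewrite subKn // -ltnS.
Qed.

Lemma eq_conv (T1 T2 : Type) (V : zmodType) (F G : T1 -> T2 -> V) a b :
  (forall i j, F (a i) (b j) = G (a i) (b j)) -> conv F a b = conv G a b.
Proof. by move=> FG; apply/funext => n; apply: eq_bigr => i _. Qed.

Lemma eq_conv3 (T1 T2 T3 : Type) (V : zmodType) (F G : T1 -> T2 -> T3 -> V) a b c :
  (forall i j l, F (a i) (b j) (c l) = G (a i) (b j) (c l)) -> conv3 F a b c = conv3 G a b c.
Proof. by move=> FG; apply/funext => n; apply: eq_bigr => i _; apply: eq_bigr. Qed.

Lemma conv3D (T1 T2 T3 : Type) (V : zmodType) (F G : T1 -> T2 -> T3 -> V) a b c :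
  conv3 (fun u v w => F u v w + G u v w) a b c = conv3 F a b c + conv3 G a b c.
Proof.
by apply/funext => n; rewrite -[RHS]big_split; apply: eq_bigr => i _; rewrite big_split.
Qed.

Lemma conv0n (T1 T2 : Type) (V : zmodType) (F : T1 -> T2 -> V) a b :
  conv F a b 0%N = F (a 0%N) (b 0%N).
Proof. by rewrite /conv big_ord1 subn0. Qed.

(** All that the rest of the argument uses of an algebra in the category. The integer grading is
    replaced by the sign operator, so the rules hold for inhomogeneous elements and neither series
    nor pairs need a grading of their own. *)
Record dgbvq_alg (V : zmodType) (mul : V -> V -> V) (s D d : {additive V -> V}) : Prop :=
  DGBVqAlg {
  q_super : super_alg mul s D;
  q_der : odd_derivation mul s D d;
  q_dd : forall a, d (d a) = 0;
  q_comm : forall a b, s a = a -> mul a b = mul b a;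
  q_even_Poisson : forall a b c, s a = a ->
    bracket mul s D a (mul b c) =
    mul (bracket mul s D a b) c + mul (s b) (bracket mul s D a c);
  q_odd_Poisson : forall a b c, s a = - a ->
    bracket mul s D a (mul b c) =
    mul (bracket mul s D a b) c + mul b (bracket mul s D a c);
  q_div : forall n (v : V), (0 < n)%N -> exists w, w *+ n = v;
  q_tors : forall n (v : V), (0 < n)%N -> v *+ n = 0 -> v = 0;
  q_exD : forall v, range D v -> d v = 0 -> exists u, v = d (D u);
  q_exd : forall v, range d v -> D v = 0 -> exists u, v = d (D u);
  q_even_dD : forall v u, s v = v -> v = d (D u) ->
    exists w, [/\ s w = - w, range D w & v = d w];
  q_odd_dD : forall v u, s v = - v -> v = d (D u) ->
    exists w, [/\ s w = w, range D w & v = d w];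
  q_rep : forall v, d v = 0 -> exists u, D (v - d u) = 0
}.

Lemma dgbvq_algP (k : algType rat) (gk : grading k) (A : dgbv gk) : in_DGBVq A ->
  dgbvq_alg *%R (gsign (gr A)) (Delta A) (delta A).
Proof.
move=> Aq; split.
- exact: dgbv_super.
- exact: delta_odd_derivation.
- exact: delta2.
- by move=> a b; apply: even_commr.
- exact: even_Poisson.
- exact: odd_Poisson.
- by move=> n v n0; exists (qdiv n v); apply: qdivK.
- exact: mulrn_eq0_rat.
- exact: exact_dD_of_D.
- exact: exact_dD_of_d.
- exact: even_dD.
- exact: odd_dD.
- exact: ker_rep.
Qed.

Definition smap (U V : Type) (f : U -> V) (a : nat -> U) : nat -> V := fun n => f (a n).

Section Smap.
Variables (U V : zmodType) (f : {additive U -> V}).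
Lemma smap_additive : zmod_morphism (smap f).
Proof. by move=> a b; apply/funext => n; rewrite /smap raddfB. Qed.
HB.instance Definition _ :=
  GRing.isZmodMorphism.Build (nat -> U) (nat -> V) (smap f) smap_additive.
End Smap.

Section SeriesSuper.
Variables (V : zmodType) (mul : V -> V -> V) (s D d : {additive V -> V}).
Hypothesis SA : super_alg mul s D.
Notation br := (bracket mul s D).
Notation smul := (conv mul).
Notation sbr := (bracket smul (smap s) (smap D)).
Implicit Types a b c x y : nat -> V.

Lemma conv_additive_r (F : V -> V -> V) a : (forall u, zmod_morphism (F u)) ->
  zmod_morphism (conv F a).
Proof.
move=> FB b c; apply/funext => n; rewrite -[RHS]sumrB.
by apply: eq_bigr => i _; rewrite FB.
Qed.

Lemma conv_additive_l (F : V -> V -> V) b : (forall u, zmod_morphism (F^~ u)) ->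
  zmod_morphism (fun a => conv F a b).
Proof.
move=> FB a c; apply/funext => n; rewrite -[RHS]sumrB.
by apply: eq_bigr => i _; rewrite FB.
Qed.

Lemma smap_conv (U W : zmodType) (f : {additive U -> W}) (F : V -> V -> U) a b :
  smap f (conv F a b) = conv (fun u v => f (F u v)) a b.
Proof. by apply/funext => n; rewrite /smap raddf_sum. Qed.

Lemma conv_smap_l (F : V -> V -> V) (f : V -> V) a b :
  conv F (smap f a) b = conv (fun u v => F (f u) v) a b.
Proof. by []. Qed.

Lemma conv_smap_r (F : V -> V -> V) (f : V -> V) a b :
  conv F a (smap f b) = conv (fun u v => F u (f v)) a b.
Proof. by []. Qed.

Lemma convB (F G : V -> V -> V) a b :
  conv F a b - conv G a b = conv (fun u v => F u v - G u v) a b.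
Proof. by apply/funext => n; rewrite -[LHS]sumrB. Qed.

Lemma convD (F G : V -> V -> V) a b :
  conv F a b + conv G a b = conv (fun u v => F u v + G u v) a b.
Proof. by apply/funext => n; rewrite -[LHS]big_split. Qed.

Lemma sbrE a b : sbr a b = conv br a b.
Proof.
rewrite /bracket smap_conv.
transitivity (conv (fun u v => D (mul (s u) v)) a b -
  conv (fun u v => mul (D (s u)) v) a b - conv (fun u v => mul u (D v)) a b) => //.
by rewrite !convB.
Qed.

Lemma series_super : super_alg smul (smap s) (smap D).
Proof.
split.
- by move=> a; apply: conv_additive_r; apply: (sup_mulr_morph SA).
- by move=> a; apply: conv_additive_l; apply: (sup_mull_morph SA).
- move=> a b /=; rewrite smap_conv conv_smap_l conv_smap_r.
  by apply: eq_conv => i j; rewrite (sup_signM SA).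
- by move=> a; apply/funext => n; rewrite /= /smap (sup_signK SA).
- by move=> a; apply/funext => n; rewrite /= /smap (sup_signD SA).
- by move=> a; apply/funext => n; rewrite /= /smap (sup_DD SA).
Qed.

Lemma series_odd_derivation : odd_derivation mul s D d ->
  odd_derivation smul (smap s) (smap D) (smap d).
Proof.
move=> [dM dD ds]; split.
- move=> a b /=; rewrite smap_conv !conv_smap_l conv_smap_r convD.
  by apply: eq_conv => i j; rewrite dM.
- by move=> a; apply/funext => n; rewrite /= /smap dD.
- by move=> a; apply/funext => n; rewrite /= /smap ds.
Qed.

Lemma series_comm a b : (forall u v, s u = u -> mul u v = mul v u) ->
  smap s a = a -> smul a b = smul b a.
Proof.
move=> uC sa; rewrite conv_sym; apply: eq_conv => i j.
by rewrite uC // -[in RHS]sa.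
Qed.

(** [e] is the sign operator for even [a] and the identity for odd [a], so that one proof serves
    both Poisson rules. *)
Lemma series_Poisson (e : V -> V) a b c :
    (forall i v w, br (a i) (mul v w) = mul (br (a i) v) w + mul (e v) (br (a i) w)) ->
  sbr a (smul b c) = smul (sbr a b) c + smul (smap e b) (sbr a c).
Proof.
move=> aP; have brB u : zmod_morphism (br u) := bracketBr _ _ (sup_mulr_morph SA) (raddfB D).
rewrite !sbrE conv_conv_r // conv_conv_l; last by move=> w; apply: (sup_mull_morph SA).
rewrite conv_conv_r; last exact: (sup_mulr_morph SA).
rewrite [X in _ + X]conv3_swap.
rewrite -[X in _ = _ + X]/(conv3 (fun u v w => mul (e v) (br u w)) a b c) -conv3D.
by apply: eq_conv3 => i j l; rewrite aP.
Qed.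

End SeriesSuper.

(** * Power series over a DGBV algebra *)

Section Series.
Variables (V : zmodType) (mul : V -> V -> V) (s D d : {additive V -> V}).
Hypothesis Q : dgbvq_alg mul s D d.
Notation br := (bracket mul s D).
Notation smul := (conv mul).
Notation S := (smap s).
Notation SD := (smap D).
Notation sbr := (bracket smul (smap s) (smap D)).
Implicit Types a b c x y g : nat -> V.
Let SA := q_super Q.
Let SSA := series_super SA.

Lemma sbr_additive a : zmod_morphism (sbr a).
Proof. exact: (bracketBr _ _ (sup_mulr_morph SSA) (raddfB _)). Qed.

(* the differential delta_{x(t)} *)
Definition dx x y : nat -> V := smap d y + sbr x y.

Lemma dx_additive x : zmod_morphism (dx x).
Proof. by move=> a b; rewrite /dx sbr_additive raddfB /=; abelian. Qed.

Lemma sbr_odd_derivation x : S x = x -> SD x = 0 -> odd_derivation smul S SD (sbr x).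
Proof.
move=> sx Dx; apply: (br_odd_derivation SSA) => // a b.
apply: (series_Poisson SA) => i v w; apply: (q_even_Poisson Q).
by rewrite -[in RHS]sx.
Qed.

Lemma sbr_odd_der g a b : S g = - g ->
  sbr g (smul a b) = smul (sbr g a) b + smul a (sbr g b).
Proof.
move=> sg; apply: (series_Poisson SA (e := id)) => i v w; apply: (q_odd_Poisson Q).
by rewrite -[s _]/(S g i) sg.
Qed.

Lemma dx_odd_derivation x : S x = x -> SD x = 0 -> odd_derivation smul S SD (dx x).
Proof.
move=> sx Dx; apply: (odd_derivationD SSA); last exact: sbr_odd_derivation.
exact: series_odd_derivation (q_der Q).
Qed.

Lemma smulrn_eq0 n a : (0 < n)%N -> a *+ n = 0 -> a = 0.
Proof.
move=> n0 an; apply/funext => i; apply: (q_tors Q n0).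
by have := congr1 (fun u => u i) an; rewrite natmulfctE.
Qed.

(** Twice the left-hand side of the Maurer-Cartan equation, which avoids the scalar 1/2 in a bare
    abelian group. *)
Definition curv x : nat -> V := smap d x *+ 2 + sbr x x.

Record MC x : Prop := { MC0 : x 0%N = 0; MCs : S x = x; MCD : SD x = 0; MCeq : curv x = 0 }.

Lemma smap_dd a : smap d (smap d a) = 0.
Proof. by apply/funext => n; rewrite /smap (q_dd Q). Qed.

Lemma smap_d_sbr x y : S x = x -> SD x = 0 ->
  smap d (sbr x y) = sbr (smap d x) y - sbr x (smap d y).
Proof. exact: (der_br_even SSA (series_odd_derivation (q_der Q))). Qed.

(** Twice the square of the twisted differential is the bracket with the curvature. *)
Lemma dx_dx x y : MC x -> dx x (dx x y) = 0.
Proof.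
move=> [x0 sx Dx xMC]; apply: (@smulrn_eq0 2) => //.
have dP := series_odd_derivation (q_der Q).
have bP := sbr_odd_derivation sx Dx.
rewrite {1}/dx raddfD /= /dx smap_dd smap_d_sbr // (bracketDr SSA).
rewrite -[RHS](_ : sbr (curv x) y = 0); last first.
  by rewrite xMC (bracket0l SSA).
rewrite /curv (mulr2n (smap d x)) (bracketDl SSA) (bracketDl SSA (smap d x)) /=.
rewrite -(br_br_even SSA y sx Dx bP). abelian.
Qed.

(** The Bianchi identity. Holding for any even [D]-closed series, it applies to a partial
    Maurer-Cartan solution and makes the next obstruction closed. *)
Lemma dx_curv x : S x = x -> SD x = 0 -> dx x (curv x) = 0.
Proof.
move=> sx Dx; have dP := series_odd_derivation (q_der Q).
have xC y : smul x y = smul y x by apply: (series_comm _ _ sx); apply: (q_comm Q).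
have bb : sbr x (sbr x x) = 0.
  apply: (@smulrn_eq0 3) => //; apply: (br_br_br SSA) => //; exact: sbr_odd_derivation.
have e : sbr (smap d x) x = - sbr x (smap d x).
  have [_ dD ds] := dP.
  have Ddx : SD (smap d x) = 0 by apply: (der_ker dP).
  rewrite (br_ker SSA) // (br_ker SSA) // (der_odd dP) //= sx (sup_mulNr SSA) xC.
  by rewrite raddfN.
rewrite /dx /curv (mulr2n (smap d x)) raddfD (raddfD _ (smap d x)) /= smap_dd smap_d_sbr //.
rewrite (bracketDr SSA) (bracketDr SSA x (smap d x)) bb e.
abelian.
Qed.

End Series.

(** * Formal manipulations of power series *)

Section Shift.
Variable U : zmodType.
Implicit Types a b v : nat -> U.

Definition mulT a : nat -> U := fun n => if n is m.+1 then a m else 0.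
Definition divT a : nat -> U := fun n => a n.+1.
Definition monom (n : nat) (c : U) : nat -> U := fun m => if m == n then c else 0.
(* the sum over [i] of [t^i u_i] *)
Definition summ (u : nat -> nat -> U) : nat -> U :=
  fun n => \sum_(i < n.+1) u i (n - i)%N.

Lemma seqD a b n : (a + b) n = a n + b n.
Proof. by []. Qed.

Lemma seqB a b n : (a - b) n = a n - b n.
Proof. by []. Qed.

Lemma seqN a n : (- a) n = - a n.
Proof. by []. Qed.

Lemma seqM a p n : (a *+ p) n = a n *+ p.
Proof. by rewrite natmulfctE. Qed.

Lemma divTK v : v 0%N = 0 -> mulT (divT v) = v.
Proof. by move=> v0; apply/funext => -[|n]. Qed.

Lemma mulT_inj a b : mulT a = mulT b -> a = b.
Proof. by move=> ab; apply/funext => n; have := congr1 (fun f => f n.+1) ab. Qed.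

Lemma summ_recl (u : nat -> nat -> U) : summ u = u 0%N + mulT (summ (fun i => u i.+1)).
Proof.
apply/funext => -[|n]; first by rewrite /summ big_ord1 seqD addr0.
by rewrite /summ big_ord_recl subn0.
Qed.

Lemma summB (u v : nat -> nat -> U) : summ (fun i => u i - v i) = summ u - summ v.
Proof. by apply/funext => n; rewrite -[RHS]sumrB. Qed.

Lemma summD (u v : nat -> nat -> U) : summ (fun i => u i + v i) = summ u + summ v.
Proof. by apply/funext => n; rewrite -[RHS]big_split. Qed.

(** Peel off some [u] with the same constant term, divide the remainder by [t] and iterate; each
    coefficient of the sum involves finitely many steps, so no convergence question arises. *)
Lemma summ_decomp (P R : set (nat -> U)) :
    (forall v, P v -> exists u, [/\ R u, u 0%N = v 0%N & P (divT (v - u))]) ->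
  forall v, P v -> exists2 u, forall i, R (u i) & v = summ u.
Proof.
move=> step v Pv.
have /choice[nxt nxtP] : forall w, exists u,
    P w -> [/\ R u, u 0%N = w 0%N & P (divT (w - u))].
  by move=> w; have [/step[u]|nPw] := pselect (P w); [exists u|exists 0].
pose it i w := iter i (fun w => divT (w - nxt w)) w.
have Pit i : P (it i v) by elim: i => //= i /nxtP[].
exists (fun i => nxt (it i v)) => [i|]; first by have [] := nxtP _ (Pit i).
apply/funext => n; clear Pit; rewrite /it {it}; elim: n v Pv => [|n IH] v Pv.
  by rewrite /summ big_ord1 /=; have [_ ->] := nxtP _ Pv.
have [_ _ /IH IHn] := nxtP _ Pv; rewrite summ_recl [RHS]seqD -[LHS](subrK (nxt v n.+1)).
rewrite -[X in X + _]/((v - nxt v) n.+1) -[X in X + _]/(divT (v - nxt v) n) IHn addrC.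
congr (_ + _); apply: eq_bigr => i _.
by rewrite -iterSr.
Qed.

(** Construction one coefficient at a time. Since [P n] looks only at coefficients up to [n], the
    diagonal of the truncations inherits every condition. *)
Lemma seq_build (P : nat -> set (nat -> U)) :
    (forall n a b, (forall m, (m <= n)%N -> a m = b m) -> P n a -> P n b) ->
    (forall n a, (forall m, (m < n)%N -> P m a) -> (forall m, (n <= m)%N -> a m = 0) ->
       exists c, P n (a + monom n c)) ->
  exists a, forall n, P n a.
Proof.
move=> Pext step.
have /choice[F FP] : forall na : nat * (nat -> U), exists c,
    (forall m, (m < na.1)%N -> P m na.2) -> (forall m, (na.1 <= m)%N -> na.2 m = 0) ->
    P na.1 (na.2 + monom na.1 c).
  move=> [n a] /=.
  have [/step h|] := pselect (forall m, (m < n)%N -> P m a); last by exists 0.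
  have [/h[c]|] := pselect (forall m, (n <= m)%N -> a m = 0); last by exists 0.
  by exists c.
pose fix A n := if n is m.+1 then A m + monom m (F (m, A m)) else 0 : nat -> U.
have AS n m : (m < n)%N -> A n.+1 m = A n m.
  by move=> mn; rewrite /= seqD /monom ltn_eqF // addr0.
have A0 n m : (n <= m)%N -> A n m = 0.
  elim: n => // n IH nm; rewrite /= seqD IH 1?ltnW // add0r /monom.
  by rewrite gtn_eqF.
have AE n m k : (m < n)%N -> A (n + k)%N m = A n m.
  move=> mn; elim: k => [|k IH]; first by rewrite addn0.
  by rewrite addnS AS // ltn_addr.
have AP n : forall m, (m < n)%N -> P m (A n).
  elim: n => // n IH m; rewrite ltnS leq_eqVlt => /predU1P[->|mn].
    by apply: (FP (n, A n)) => //= m' /A0.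
  by apply: Pext (IH m mn) => m' m'm; rewrite AS // (leq_ltn_trans m'm).
(* [A m.+1] is the first truncation in which coefficient [m] has its final value. *)
exists (fun m => A m.+1 m) => n; apply: Pext (AP n.+1 n (ltnSn n)) => m mn.
by rewrite -(subnKC mn) -addSn AE.
Qed.

End Shift.

Lemma summ_smap (U V : zmodType) (f : {additive U -> V}) (u : nat -> nat -> U) :
  smap f (summ u) = summ (fun i => smap f (u i)).
Proof. by apply/funext => n; rewrite /smap raddf_sum. Qed.

Lemma summ_conv (T : Type) (U V : zmodType) (F : T -> U -> V) a u :
    (forall w, zmod_morphism (F w)) ->
  conv F a (summ u) = summ (fun i => conv F a (u i)).
Proof.
move=> FB; apply/funext => n.
rewrite -[RHS](triangle_swap n (fun i j => F (a i) (u j (n - j - i)%N))).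
apply: eq_bigr => i _; rewrite (zmod_morph_sum _ (FB _)).
by apply: eq_bigr => j _; rewrite subnAC.
Qed.

Lemma summ_convl (T : Type) (U V : zmodType) (F : U -> T -> V) b u :
    (forall w, zmod_morphism (F^~ w)) ->
  conv F (summ u) b = summ (fun i => conv F (u i) b).
Proof.
move=> FB; apply/funext => n.
rewrite -[RHS](triangle_assoc n (fun i j l => F (u i j) (b l))).
by apply: eq_bigr => m _; rewrite (zmod_morph_sum _ (FB _)).
Qed.

Lemma conv_mulT (T : Type) (U V : zmodType) (F : T -> U -> V) a b :
  (forall w, F w 0 = 0) -> conv F a (mulT b) = mulT (conv F a b).
Proof.
move=> F0; apply/funext => -[|n]; first by rewrite conv0n F0.
rewrite /conv big_ord_recr /= subnn F0 addr0.
by apply: eq_bigr => i _; rewrite subSn //= -ltnS.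
Qed.

Lemma conv_vanish (T U V : zmodType) (F : T -> U -> V) a b p q n :
    (forall w, F w 0 = 0) -> (forall w, F 0 w = 0) ->
    (forall m, (m < p)%N -> a m = 0) -> (forall m, (m < q)%N -> b m = 0) ->
  (n < p + q)%N -> conv F a b n = 0.
Proof.
move=> F0r F0l ap bq npq; apply: big1 => i _.
have [/ap->//|pi] := ltnP i p; rewrite bq ?F0r //; have := ltn_ord i; lia.
Qed.

Lemma rangeN (U V : zmodType) (f : {additive U -> V}) v : range f v -> range f (- v).
Proof. by move=> [u _ <-]; exists (- u) => //; rewrite raddfN. Qed.

Lemma rangeD (U V : zmodType) (f : {additive U -> V}) v w :
  range f v -> range f w -> range f (v + w).
Proof. by move=> [u _ <-] [u' _ <-]; exists (u + u') => //; rewrite raddfD. Qed.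

Lemma range_muln (U V : zmodType) (f : {additive U -> V}) v n :
  range f v -> range f (v *+ n).
Proof. by move=> [u _ <-]; exists (u *+ n) => //; rewrite raddfMn. Qed.

Lemma range_smap (U V : Type) (f : U -> V) a n : range f (smap f a n).
Proof. by exists (a n). Qed.

(** * Lifts of classes and Maurer-Cartan solutions, built coefficient by coefficient *)

Section Lifts.
Variables (V : zmodType) (mul : V -> V -> V) (s D d : {additive V -> V}).
Hypothesis Q : dgbvq_alg mul s D d.
Notation br := (bracket mul s D).
Notation smul := (conv mul).
Notation S := (smap s).
Notation SD := (smap D).
Notation sbr := (bracket smul (smap s) (smap D)).
Notation dx := (dx mul s D d).
Notation MC := (MC mul s D d).
Notation curv := (curv mul s D d).
Implicit Types a b x y z w g : nat -> V.
Let SA := q_super Q.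
Let SSA := series_super SA.

Lemma dxB x a b : dx x (a - b) = dx x a - dx x b.
Proof. exact: (dx_additive Q). Qed.

Lemma dxx0 x : dx x 0 = 0.
Proof. by have := dxB x 0 0; rewrite !subrr. Qed.

Lemma dxN x a : dx x (- a) = - dx x a.
Proof. by rewrite -(sub0r a) dxB dxx0 sub0r. Qed.

Lemma dxD x a b : dx x (a + b) = dx x a + dx x b.
Proof. by rewrite -{1}(opprK b) dxB dxN opprK. Qed.

Lemma br0r u : br u 0 = 0.
Proof. by have := @bracketBr _ mul s D u (sup_mulr_morph SA) (raddfB D) 0 0; rewrite !subrr. Qed.

Lemma br_additive u : zmod_morphism (br u).
Proof. exact: (bracketBr _ _ (sup_mulr_morph SA) (raddfB D)). Qed.

Lemma dxE x a n : dx x a n = d (a n) + conv br x a n.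
Proof. by rewrite /dx sbrE. Qed.

(** As [x] has no constant term, bracketing with it raises the order. This turns identities for the
    twisted differential into [d]-closedness of leading coefficients. *)
Lemma dx_lead x a n : x 0%N = 0 -> (forall m, (m < n)%N -> a m = 0) ->
  dx x a n = d (a n).
Proof.
move=> x0 an; rewrite dxE (conv_vanish (p := 1) (q := n)) ?addr0 //.
- exact: br0r.
- exact: (bracket0l SA).
- by case.
Qed.

Lemma dx_mulT x a : dx x (mulT a) = mulT (dx x a).
Proof.
apply/funext => -[|n]; rewrite dxE (conv_mulT _ _ br0r) /= ?raddf0 ?addr0 //.
by rewrite dxE.
Qed.

Lemma dx_summ x u : dx x (summ u) = summ (fun i => dx x (u i)).
Proof.
by rewrite /dx summD sbrE (summ_conv _ _ br_additive) summ_smap (funext (sbrE mul s D x)).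
Qed.

(** When [a n = 0] only the bracket contributes, and on [Ker D] it is [D]-exact. *)
Lemma dx_range x a n : SD x = 0 -> SD a = 0 -> a n = 0 -> range D (dx x a n).
Proof.
move=> Dx Da an; rewrite /dx (br_ker SSA) //= seqD /smap an raddf0 add0r.
exact: range_smap.
Qed.

Lemma SD_range a : (forall n, D (a n) = 0) -> SD a = 0.
Proof. by move=> Da; apply/funext. Qed.

Lemma D_range v : range D v -> D v = 0.
Proof. by move=> [u _ <-]; apply: (sup_DD SA). Qed.

(* the series y(t) that represent the values of phi_{x(t)} *)
Record ser_lift x y : Prop := SerLift {
  lift_D : SD y = 0;
  lift_dx : dx x y = 0;
  lift_range : forall n, (0 < n)%N -> range D (y n)
}.

Lemma lift_D0 x y n : ser_lift x y -> D (y n) = 0.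
Proof. by move=> [/(congr1 (fun f => f n))]. Qed.

Lemma lift_d0 x y : x 0%N = 0 -> ser_lift x y -> d (y 0%N) = 0.
Proof. by move=> x0 [_ dy _]; rewrite -(dx_lead (x := x)) // dy. Qed.

Lemma liftB x y z : ser_lift x y -> ser_lift x z -> ser_lift x (y - z).
Proof.
move=> [Dy dy ry] [Dz dz rz]; split.
- by rewrite raddfB /= Dy Dz subrr.
- by rewrite dxB dy dz subrr.
- by move=> n n0; apply: rangeD (ry n n0) _; apply: rangeN; apply: rz.
Qed.

(** The obstruction at order [n] is [d]-closed because [dx x] squares to zero, and [D]-exact because
    the truncation lies in [Ker D]; hence it is [d (D u)], and [- D u] is the next coefficient. *)
Lemma lift_exists x (y0 : V) : MC x -> d y0 = 0 -> D y0 = 0 ->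
  exists2 y, ser_lift x y & y 0%N = y0.
Proof.
move=> xMC dy0 Dy0; have [x0 sx Dx _] := xMC.
pose P n : set (nat -> V) := fun a =>
  [/\ n = 0%N -> a 0%N = y0, (0 < n)%N -> range D (a n) & dx x a n = 0].
have DP n a : P n a -> D (a n) = 0.
  by case=> + + _; case: n => [/(_ erefl) ->|n _ /(_ isT)/D_range].
suff [y yP] : exists y, forall n, P n y.
  exists y; last by have [->] := yP 0%N.
  split; first by apply: SD_range => n; apply: DP.
    by apply/funext => n; have [] := yP n.
  by move=> n n0; have [_ /(_ n0)] := yP n.
apply: seq_build => [n a b ab [a0 aD adx]|n a Pa an].
  split; first by move=> n0; rewrite -ab ?a0 // n0.
    by rewrite -ab.
  rewrite -adx !dxE ab //; congr (_ + _); apply: eq_bigr => i _.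
  by rewrite ab // leq_subr.
have Da : SD a = 0.
  by apply: SD_range => m; have [/Pa/DP//|/an->] := ltnP m n; rewrite raddf0.
have dxn (c : V) : dx x (a + monom n c) n = dx x a n + d c.
  rewrite dxD seqD (dx_lead (a := monom n c)) //; first by rewrite /monom eqxx.
  by move=> m mn; rewrite /monom ltn_eqF.
have d0 : d (dx x a n) = 0.
  rewrite -(dx_lead (x := x)) //; last by move=> m /Pa[].
  by rewrite (dx_dx Q).
have [n0|n0] := posnP n.
  subst n; exists y0; split=> // [_|]; first by rewrite seqD an // add0r.
  by rewrite dxn dxE an // conv0n an // br0r raddf0 add0r add0r dy0.
have [u du] := q_exD Q (dx_range Dx Da (an n (leqnn n))) d0.
exists (- D u); split=> [nn|_|]; first by rewrite nn in n0.
  by rewrite seqD an // add0r /monom eqxx; apply: rangeN; exists u.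
by rewrite dxn du raddfN subrr.
Qed.

(** Write the constant term as [d (D u)], subtract [dx x (D u)] and divide by [t]. The result is
    again a lift, and its constant term, closed and now [D]-exact, has the same form, so the process
    repeats. *)
Lemma lift_coboundary x z : MC x -> ser_lift x z -> range d (z 0%N) -> exists w, z = dx x w.
Proof.
move=> xMC zl dz0; have [x0 sx Dx _] := xMC.
pose P : set (nat -> V) := fun z => ser_lift x z /\ exists u, z 0%N = d (D u).
pose R : set (nat -> V) := fun u => exists w, u = dx x w.
have step z' : P z' -> exists u, [/\ R u, u 0%N = z' 0%N & P (divT (z' - u)%R)].
  move=> {zl dz0}; move: z' => {}z [[Dz dz rz] [u z0]].
  have zu0 : (z - dx x (monom 0 (D u))) 0%N = 0.
    by rewrite seqB dx_lead // /monom eqxx z0 subrr.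
  exists (dx x (monom 0 (D u))); split; first by exists (monom 0 (D u)).
    by rewrite dx_lead // /monom eqxx z0.
  have Dm : SD (monom 0 (D u)) = 0.
    by apply: SD_range => n; rewrite /monom; case: eqP; rewrite ?raddf0 ?(sup_DD SA).
  have rd n : range D (divT (z - dx x (monom 0 (D u))) n).
    by apply: rangeD; [exact: rz|apply: rangeN; apply: dx_range].
  have dd : dx x (divT (z - dx x (monom 0 (D u)))) = 0.
    apply: mulT_inj; rewrite -dx_mulT divTK // dxB dz (dx_dx Q) // subrr.
    by apply/funext => -[].
  split; first by split=> //; apply: SD_range => n; apply: D_range.
  by apply: (q_exD Q) => //; rewrite -(dx_lead (x := x)) // dd.
have Pz : P z by split=> //; apply: (q_exd Q) => //; exact: lift_D0 zl.
have [u /choice[w wu] ->] := summ_decomp step Pz; exists (summ w); rewrite dx_summ; congr summ.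
by apply/funext.
Qed.

(* Injectivity of phi. *)
Lemma summ_lift_exact x u w : MC x -> (forall i, ser_lift x (u i)) -> summ u = dx x w ->
  forall i, range d (u i 0%N).
Proof.
move=> xMC + + i; have [x0 sx Dx _] := xMC.
elim: i u w => [|i IH] u w ul uw.
  exists (w 0%N) => //; rewrite -(dx_lead (x := x)) // -uw.
  by rewrite /summ big_ord1.
have u0 : u 0%N 0%N = d (w 0%N).
  by rewrite -(dx_lead (x := x)) // -uw /summ big_ord1.
have [w' uw'] : exists w', u 0%N = dx x w'.
  by apply: lift_coboundary => //; rewrite u0; exists (w 0%N).
have dc : d ((w - w') 0%N) = 0.
  rewrite seqB raddfB /= -u0 uw' dx_lead // subrr //.
have [e De] := q_rep Q dc.
have dce : d ((w - w') 0%N - d e) = 0 by rewrite raddfB /= dc (q_dd Q) subrr.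
have [l ll l0] := lift_exists xMC dce De.
(* [dx x] kills both [l] and [dx x (monom 0 e)]; subtracting them removes the constant term of the
   primitive, so that the whole equation can be divided by [t]. *)
pose w2 := w - w' - l - dx x (monom 0 e).
have w20 : w2 0%N = 0.
  by rewrite /w2 !(seqB (_ - _)) l0 dx_lead // /monom eqxx; abelian.
apply: (IH (fun j => u j.+1) (divT w2)) => //.
apply: mulT_inj; rewrite -dx_mulT divTK // /w2 !dxB (dx_dx Q) // (lift_dx ll) -uw -uw'.
by rewrite (summ_recl u); abelian.
Qed.

(* Surjectivity of phi. *)
Lemma summ_lift_decomp x v : MC x -> dx x v = 0 ->
  exists l w, (forall i, ser_lift x (l i)) /\ v = summ l + dx x w.
Proof.
move=> xMC dv; have [x0 sx Dx _] := xMC.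
pose P : set (nat -> V) := fun v => dx x v = 0.
pose R : set (nat -> V) := fun u => exists lw, ser_lift x lw.1 /\ u = lw.1 + dx x lw.2.
have step v' : P v' -> exists u, [/\ R u, u 0%N = v' 0%N & P (divT (v' - u)%R)].
  move: v' => {dv}v dv; have dv0 : d (v 0%N) = 0 by rewrite -(dx_lead (x := x)) // dv.
  have [e De] := q_rep Q dv0.
  have dve : d (v 0%N - d e) = 0 by rewrite raddfB /= dv0 (q_dd Q) subrr.
  have [l ll l0] := lift_exists xMC dve De.
  have lv0 : (l + dx x (monom 0 e)) 0%N = v 0%N.
    by rewrite seqD dx_lead // /monom eqxx l0 subrK.
  exists (l + dx x (monom 0 e)); split=> //; first by exists (l, monom 0 e).
  apply: mulT_inj; rewrite -dx_mulT divTK; last by rewrite seqB lv0 subrr.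
  rewrite dxB dv dxD (dx_dx Q) // (lift_dx ll) addr0 subrr.
  by apply/funext => -[].
have [u /choice[lw lwP] ->] := summ_decomp step dv.
exists (fun i => (lw i).1), (summ (fun i => (lw i).2)); split=> [i|].
  by have [] := lwP i.
rewrite dx_summ -summD; congr summ; apply/funext => i.
by have [] := lwP i.
Qed.

(** At order [n > 1] the curvature of the truncation is [d]-closed by the Bianchi identity and
    [D]-exact as a bracket of [D]-closed series; being odd, it has an even primitive in [Im D],
    which supplies the next coefficient. *)
Lemma MC_exists (x1 : V) : s x1 = x1 -> d x1 = 0 -> D x1 = 0 ->
  exists x, [/\ MC x, x 1%N = x1 & forall n, (1 < n)%N -> range D (x n)].
Proof.
move=> sx1 dx1 Dx1.
pose P n : set (nat -> V) := fun a =>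
  [/\ s (a n) = a n /\ D (a n) = 0, n = 0%N -> a 0%N = 0, n = 1%N -> a 1%N = x1,
      (1 < n)%N -> range D (a n) & curv a n = 0].
suff [x xP] : exists x, forall n, P n x.
  exists x; split.
  - split.
    + by have [_ /(_ erefl)] := xP 0%N.
    + by apply/funext => n; have [[]] := xP n.
    + by apply/funext => n; have [[]] := xP n.
    + by apply/funext => n; have [] := xP n.
  - by have [_ _ /(_ erefl)] := xP 1%N.
  - by move=> n n1; have [_ _ _ /(_ n1)] := xP n.
have curvE a n : curv a n = d (a n) *+ 2 + conv br a a n.
  by rewrite /curv sbrE seqD seqM.
apply: seq_build => [n a b ab [[sa Da] a0 a1 ra ca]|n a Pa an].
  split.
  - by rewrite -!ab.
  - by move=> n0; rewrite -ab ?a0 // n0.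
  - by move=> n1; rewrite -ab ?a1 // n1.
  - by rewrite -ab.
  rewrite -ca !curvE ab //; congr (_ + _); apply: eq_bigr => i _.
  by rewrite !ab ?leq_subr // -ltnS.
have Sa : S a = a.
  by apply/funext => m; rewrite /smap; have [/Pa[[]]//|/an->] := ltnP m n; rewrite raddf0.
have Da : SD a = 0.
  by apply/funext => m; rewrite /smap; have [/Pa[[]]//|/an->] := ltnP m n; rewrite raddf0.
have a0 : a 0%N = 0.
  by have [n0|n0] := posnP n; [rewrite an // n0|have [_ ->] := Pa 0%N n0].
have am (c : V) m : (m < n)%N -> (a + monom n c) m = a m.
  by move=> mn; rewrite seqD /monom ltn_eqF // addr0.
have an' (c : V) : (a + monom n c) n = c by rewrite seqD an // add0r /monom eqxx.
have [n0|n0] := posnP n.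
  subst n; exists 0; split=> //; rewrite ?an' ?raddf0 //.
  by rewrite curvE conv0n an' br0r raddf0 mul0rn addr0.
(* In the convolution [c] is paired only with the coefficient of index 0, which vanishes. *)
have curvn (c : V) : curv (a + monom n c) n = curv a n + d c *+ 2.
  rewrite !curvE an' an // raddf0 mul0rn add0r addrC; congr (_ + _).
  apply: eq_bigr => i _; have [i0|i0] := posnP i.
    by rewrite i0 (am c 0%N n0) a0 !(bracket0l SA).
  have [->|ni] := eqVneq (nat_of_ord i) n.
    by rewrite subnn (am c 0%N n0) a0 !br0r.
  by rewrite !am //; have := ltn_ord i; lia.
have [n1|n1] := leqP n 1.
  have {n0 n1}n1 : n = 1%N by lia.
  subst n; exists x1; split=> //; rewrite ?an' //.
  rewrite curvn dx1 mul0rn addr0 curvE an // raddf0 mul0rn add0r.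
  by rewrite /conv !big_ord_recl big_ord0 /= a0 br0r (bracket0l SA) !addr0.
have ca : d (curv a n) = 0.
  rewrite -(dx_lead (x := a)) //; last by move=> m /Pa[].
  by rewrite (dx_curv Q).
have sbr_a : sbr a a = SD (smul a a) by rewrite (br_ker SSA) //= Sa.
have rca : range D (curv a n).
  rewrite /curv seqD seqM /smap an // raddf0 mul0rn add0r sbr_a.
  exact: range_smap.
have sca : s (curv a n) = - curv a n.
  rewrite -[LHS]/(S (curv a) n) -seqN; congr (_ n).
  have aP : odd_derivation smul S SD (sbr a) by apply: (sbr_odd_derivation Q).
  have [_ _ ds] := series_odd_derivation (q_der Q); have [_ _ bs] := aP.
  by rewrite /curv raddfD raddfMn /= ds bs /= Sa; abelian.
have [u cu] := q_exD Q rca ca.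
have [w [sw [u' _ Du'] cw]] := q_odd_dD Q sca cu.
(* The curvature changes by [2 d c], so the correction is half of [w]; halving the preimage [u']
   keeps it in [Im D]. *)
have [e ue] := q_div Q u' (isT : 0 < 2)%N.
have we : w = D e *+ 2 by rewrite -Du' -ue raddfMn.
exists (- D e); split; rewrite ?an' //.
- split; last by rewrite raddfN /= (sup_DD SA) oppr0.
  apply/eqP; rewrite -subr_eq0; apply/eqP; apply: (q_tors Q (isT : 0 < 2)%N).
  by rewrite mulrnBl raddfN mulNrn -raddfMn /= -we sw mulNrn -we subrr.
- by move=> n0'; rewrite n0' in n0.
- by move=> n1'; rewrite n1' in n1.
- by move=> _; apply: rangeN; exists e.
by rewrite curvn cw we raddfMn raddfN mulNrn subrr.
Qed.

End Lifts.

(* t d/dt *)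
Definition euler (U : zmodType) (a : nat -> U) : nat -> U := fun n => a n *+ n.

Lemma eulerB (U : zmodType) (a b : nat -> U) : euler (a - b) = euler a - euler b.
Proof. by apply/funext => n; rewrite /euler !seqB mulrnBl. Qed.

Lemma eulerD (U : zmodType) (a b : nat -> U) : euler (a + b) = euler a + euler b.
Proof. by apply/funext => n; rewrite /euler !seqD mulrnDl. Qed.

Lemma euler0 (U : zmodType) : euler (0 : nat -> U) = 0.
Proof. by apply/funext => n; rewrite /euler mul0rn. Qed.

Lemma euler_monom (U : zmodType) (v : U) : euler (monom 0 v) = 0.
Proof. by apply/funext => -[|n]; rewrite /euler /monom ?mulr0n ?mul0rn. Qed.

Lemma euler_smap (U V : zmodType) (f : {additive U -> V}) a :
  euler (smap f a) = smap f (euler a).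
Proof. by apply/funext => n; rewrite /euler /smap raddfMn. Qed.

Lemma euler_summ (U : zmodType) (u : nat -> nat -> U) :
  euler (summ u) = summ (fun i => euler (u i)) + summ (fun i => u i *+ i).
Proof.
apply/funext => n; rewrite seqD /euler /summ -sumrMnl -big_split; apply: eq_bigr => i _ /=.
by rewrite seqM -mulrnDr subnK // -ltnS.
Qed.

Lemma euler_conv (T U V : zmodType) (F : T -> U -> V) a b :
    (forall u, zmod_morphism (F u)) -> (forall w, zmod_morphism (F^~ w)) ->
  euler (conv F a b) = conv F (euler a) b + conv F a (euler b).
Proof.
move=> Fr Fl; apply/funext => n; rewrite seqD /euler /conv -sumrMnl -big_split.
apply: eq_bigr => i _ /=.
rewrite (zmod_morph_muln _ _ (Fr (a i))) (zmod_morph_muln _ _ (Fl (b (n - i)%N))).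
by rewrite -mulrnDr subnKC // -ltnS.
Qed.

Lemma summ_monom (U : zmodType) (a : nat -> U) : a = summ (fun i => monom 0 (a i)).
Proof.
apply/funext => n; rewrite /summ big_ord_recr /= subnn /monom eqxx big1 ?add0r // => i _.
by rewrite subn_eq0 leqNgt ltn_ord.
Qed.

(** * The flow of an infinitesimal gauge transformation *)

Section Flow.
Variables (V : zmodType) (mul : V -> V -> V) (s D d : {additive V -> V}).
Hypothesis Q : dgbvq_alg mul s D d.
Notation br := (bracket mul s D).
Notation smul := (conv mul).
Notation S := (smap s).
Notation SD := (smap D).
Notation sbr := (bracket smul (smap s) (smap D)).
Implicit Types a b x y z g : nat -> V.
Let SA := q_super Q.
Let SSA := series_super SA.

(** The equation [t dz/dt = [g, z]] with value [v] at [t = 0]. When [g 0 = 0], coefficient [n] of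
    the right-hand side involves only lower coefficients of [z], and division by [n] gives a unique
    solution. *)
Definition is_flow g (v : V) z : Prop := z 0%N = v /\ euler z = sbr g z.

Definition flow g (v : V) : nat -> V := xget 0 [set z | is_flow g v z].

Lemma sbr_g0 g z n : g 0%N = 0 ->
  sbr g z n = \sum_(i < n) br (g i.+1) (z (n - i.+1)%N).
Proof. by move=> g0; rewrite sbrE /conv big_ord_recl g0 (bracket0l SA) add0r. Qed.

(** Stated up to order [N] and for two generators, in order to compare the flows of successive
    approximations to [g] and to treat equations that hold only to finite order. *)
Lemma flow_unique g g' N z z' : g 0%N = 0 -> (forall m, (m <= N)%N -> g m = g' m) ->
    z 0%N = z' 0%N -> (forall m, (m <= N)%N -> euler z m = sbr g z m) ->
    (forall m, (m <= N)%N -> euler z' m = sbr g' z' m) ->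
  forall m, (m <= N)%N -> z m = z' m.
Proof.
move=> g0 gg' z0 ez ez'; elim/ltn_ind => -[|m] // IH mN.
apply/eqP; rewrite -subr_eq0; apply/eqP; apply: (q_tors Q (isT : 0 < m.+1)%N).
rewrite mulrnBl -/(euler z m.+1) -/(euler z' m.+1) ez // ez' // !sbr_g0 //; last by rewrite -gg'.
apply/eqP; rewrite subr_eq0; apply/eqP; apply: eq_bigr => i _.
have im := ltn_ord i; rewrite -gg'; last by lia.
rewrite IH //; lia.
Qed.

Lemma flow_exists g v : g 0%N = 0 -> exists z, is_flow g v z.
Proof.
move=> g0.
suff [z zP] : exists z : nat -> V, forall n,
    (n = 0%N -> z 0%N = v) /\ z n *+ n = \sum_(i < n) br (g i.+1) (z (n - i.+1)%N).
  exists z; split; first by have [->] := zP 0%N.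
  by apply/funext => n; rewrite sbr_g0 //; have [_ <-] := zP n.
apply: seq_build => [n a b ab [a0 an]|n a _ an].
  split=> [n0|]; first by rewrite -ab ?a0 // n0.
  by rewrite -ab // an; apply: eq_bigr => i _; rewrite ab // leq_subr.
have [n0|n0] := posnP n.
  by subst n; exists v; split=> [_|]; rewrite ?big_ord0 // seqD an // add0r.
have [c cE] := q_div Q (\sum_(i < n) br (g i.+1) (a (n - i.+1)%N)) n0.
exists c; split; first by move=> n0'; rewrite n0' in n0.
rewrite seqD an // add0r {1}/monom eqxx cE; apply: eq_bigr => i _.
by rewrite seqD /monom ltn_eqF ?addr0 //; have := ltn_ord i; lia.
Qed.

Lemma flowP g v : g 0%N = 0 -> is_flow g v (flow g v).
Proof. by move=> g0; apply: (xgetPex 0); apply: flow_exists. Qed.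

Lemma flow_ext g g' N v : g 0%N = 0 -> g' 0%N = 0 -> (forall m, (m <= N)%N -> g m = g' m) ->
  forall m, (m <= N)%N -> flow g v m = flow g' v m.
Proof.
move=> g0 g0' gg'; have [z0 ez] := flowP v g0; have [z0' ez'] := flowP v g0'.
by apply: (flow_unique g0 gg') => [|m _|m _]; rewrite ?z0 ?z0' ?ez ?ez'.
Qed.

Section FixedGenerator.
Variable g : nat -> V.
Hypotheses (g0 : g 0%N = 0) (Sg : S g = - g) (Dg : SD g = 0).
Notation F := (flow g).

Lemma flow0 v : F v 0%N = v. Proof. by have [] := flowP v g0. Qed.

Lemma euler_flow v : euler (F v) = sbr g (F v). Proof. by have [] := flowP v g0. Qed.

(** By uniqueness the flow respects whatever bracketing with [g] respects, both sides solving the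
    same equation; the next four lemmas are instances. *)
Lemma flow_eq z v : z 0%N = v -> euler z = sbr g z -> z = F v.
Proof.
move=> z0 ez; apply/funext => n.
by apply: (flow_unique (N := n) g0) => // [|m _|m _]; rewrite ?flow0 ?euler_flow ?ez.
Qed.

Lemma flowB : zmod_morphism F.
Proof.
move=> u v; apply/esym/flow_eq; first by rewrite seqB !flow0.
by rewrite eulerB !euler_flow (sbr_additive Q).
Qed.

Lemma flowM u v : F (mul u v) = smul (F u) (F v).
Proof.
apply/esym/flow_eq; first by rewrite conv0n !flow0.
rewrite (sbr_odd_der Q) // -!euler_flow euler_conv //; first exact: (sup_mulr_morph SA).
exact: (sup_mull_morph SA).
Qed.

Lemma flow_s v : F (s v) = S (F v).
Proof.
apply/esym/flow_eq; first by rewrite /smap flow0.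
by rewrite -(sign_br_odd SSA) // euler_smap euler_flow.
Qed.

Lemma flow_D v : F (D v) = SD (F v).
Proof.
apply/esym/flow_eq; first by rewrite /smap flow0.
by rewrite (br_oddD SSA) // euler_smap euler_flow.
Qed.

Lemma range_div (v : V) n : (0 < n)%N -> range D (v *+ n) -> range D v.
Proof.
move=> n0 [u _ uv]; have [e eu] := q_div Q u n0; exists e => //.
apply/eqP; rewrite -subr_eq0; apply/eqP; apply: (q_tors Q n0).
by rewrite mulrnBl -raddfMn eu uv subrr.
Qed.

(** [n] times the coefficient is a coefficient of [[g, F v]], which is [D]-exact since [g] and [F v]
    are [D]-closed; then divide by [n]. *)
Lemma flow_range v n : (0 < n)%N -> D v = 0 -> range D (F v n).
Proof.
move=> n0 Dv; have DF : SD (F v) = 0.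
  by rewrite -flow_D Dv; have := flowB 0 0; rewrite !subrr.
apply: (range_div n0); rewrite -/(euler (F v) n) euler_flow (br_ker SSA) //.
Qed.

End FixedGenerator.
End Flow.

(** * The gauge transformation and the construction of its generator *)

Section Intertwiner.
Variables (V1 V2 : zmodType).
Variables (mul1 : V1 -> V1 -> V1) (s1 D1 d1 : {additive V1 -> V1}).
Variables (mul2 : V2 -> V2 -> V2) (s2 D2 d2 : {additive V2 -> V2}).
Hypotheses (Q1 : dgbvq_alg mul1 s1 D1 d1) (Q2 : dgbvq_alg mul2 s2 D2 d2).
Variable f : {additive V1 -> V2}.
Hypotheses (fM : forall u v, f (mul1 u v) = mul2 (f u) (f v))
  (fs : forall u, f (s1 u) = s2 (f u)) (fD : forall u, f (D1 u) = D2 (f u))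
  (fd : forall u, f (d1 u) = d2 (f u)).
Notation br1 := (bracket mul1 s1 D1).
Notation br2 := (bracket mul2 s2 D2).
Notation smul1 := (conv mul1).
Notation smul2 := (conv mul2).
Notation S1 := (smap s1).
Notation S2 := (smap s2).
Notation SD1 := (smap D1).
Notation SD2 := (smap D2).
Notation sbr1 := (bracket smul1 (smap s1) (smap D1)).
Notation sbr2 := (bracket smul2 (smap s2) (smap D2)).
Notation dx1 := (dx mul1 s1 D1 d1).
Notation dx2 := (dx mul2 s2 D2 d2).
Implicit Types (x a b : nat -> V1) (y g : nat -> V2).
Let SA1 := q_super Q1.
Let SA2 := q_super Q2.
Let SSA1 := series_super SA1.
Let SSA2 := series_super SA2.

(* [Phi g] is [f] followed by the gauge transformation of generator [g]. *)
Definition Phi g a : nat -> V2 := summ (fun i => flow mul2 s2 D2 g (f (a i))).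

Section FixedGenerator.
Variable g : nat -> V2.
Hypotheses (g0 : g 0%N = 0) (Sg : S2 g = - g) (Dg : SD2 g = 0).
Notation F := (flow mul2 s2 D2 g).

Lemma F0 : F 0 = 0.
Proof. by have := flowB Q2 g0 0 0; rewrite !subrr. Qed.

Lemma PhiB a b : Phi g (a - b) = Phi g a - Phi g b.
Proof.
rewrite /Phi -summB; congr summ; apply/funext => i.
by rewrite seqB raddfB (flowB Q2).
Qed.

Lemma Phi0 : Phi g 0 = 0.
Proof. by have := PhiB 0 0; rewrite !subrr. Qed.

Lemma PhiD a b : Phi g (a + b) = Phi g a + Phi g b.
Proof. by have := PhiB (a + b) b; rewrite addrK => ->; rewrite subrK. Qed.

Lemma Phi_0 a : Phi g a 0%N = f (a 0%N).
Proof. by rewrite /Phi /summ big_ord1 (flow0 Q2). Qed.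

Lemma Phi_mulT a : Phi g (mulT a) = mulT (Phi g a).
Proof. by rewrite /Phi summ_recl /= raddf0 F0 add0r. Qed.

Lemma Phi_summ u : Phi g (summ u) = summ (fun i => Phi g (u i)).
Proof.
apply/funext => n; rewrite /Phi /summ.
transitivity (\sum_(m < n.+1) \sum_(i < m.+1) F (f (u i (m - i)%N)) (n - m)%N).
  apply: eq_bigr => m _; rewrite raddf_sum.
  by rewrite (zmod_morph_sum _ (flowB Q2 g0)) fct_sumE.
exact: (triangle_assoc n (fun i j l => F (f (u i j)) l)).
Qed.

Lemma Phi_mul a b : Phi g (smul1 a b) = smul2 (Phi g a) (Phi g b).
Proof.
rewrite [in RHS]/Phi (summ_convl _ _ (sup_mull_morph SA2)).
transitivity (summ (fun i => summ (fun j => smul2 (F (f (a i))) (F (f (b j)))))); last first.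
  congr summ; apply/funext => i.
  by rewrite (summ_conv _ _ (sup_mulr_morph SA2)).
apply/funext => n; rewrite /Phi /summ.
rewrite -[RHS](triangle_assoc n (fun i j => smul2 (F (f (a i))) (F (f (b j))))).
apply: eq_bigr => m _; rewrite raddf_sum (zmod_morph_sum _ (flowB Q2 g0)) fct_sumE.
by apply: eq_bigr => i _; rewrite fM (flowM Q2).
Qed.

Lemma Phi_s a : Phi g (S1 a) = S2 (Phi g a).
Proof.
rewrite summ_smap; congr summ; apply/funext => i.
by rewrite [S1 a i]/(s1 (a i)) fs (flow_s Q2).
Qed.

Lemma Phi_D a : Phi g (SD1 a) = SD2 (Phi g a).
Proof.
rewrite summ_smap; congr summ; apply/funext => i.
by rewrite [SD1 a i]/(D1 (a i)) fD (flow_D Q2).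
Qed.

Lemma Phi_sbr a b : Phi g (sbr1 a b) = sbr2 (Phi g a) (Phi g b).
Proof. by rewrite /bracket !PhiB !Phi_D !Phi_mul !Phi_D !Phi_s. Qed.

Lemma euler_Phi a : euler (Phi g a) = sbr2 g (Phi g a) + Phi g (euler a).
Proof.
rewrite {1}/Phi euler_summ; congr (_ + _).
  rewrite sbrE (summ_conv _ _ (br_additive Q2)); congr summ; apply/funext => i.
  by rewrite (euler_flow Q2) // sbrE.
congr summ; apply/funext => i.
by rewrite /euler raddfMn (zmod_morph_muln _ _ (flowB Q2 g0)).
Qed.

(** Coefficient [n] consists of [f (a n)] itself and of positive-order coefficients of flows of
    [D2]-closed elements. *)
Lemma Phi_range a n : SD1 a = 0 -> range D2 (f (a n)) -> range D2 (Phi g a n).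
Proof.
move=> Da ra; rewrite /Phi /summ big_ord_recr /= subnn (flow0 Q2) //.
apply: rangeD ra; apply: (big_ind (range D2)).
- by exists 0; rewrite ?raddf0.
- exact: rangeD.
move=> i _; apply: (flow_range Q2) => //; first by rewrite subn_gt0.
by rewrite -fD -[D1 _]/(SD1 a i) Da raddf0.
Qed.

End FixedGenerator.

(** As [b] starts in order 1, coefficient [N] of [Phi g b] involves [g] only below [N]; the equation
    for the generator is therefore triangular. *)
Lemma Phi_ext g g' N b : g 0%N = 0 -> g' 0%N = 0 -> (forall m, (m < N)%N -> g m = g' m) ->
  b 0%N = 0 -> forall m, (m <= N)%N -> Phi g b m = Phi g' b m.
Proof.
move=> g0 g0' gg' b0 m mN; rewrite -(divTK b0) !Phi_mulT //.
case: m mN => //= m mN; apply: eq_bigr => i _; rewrite (flow_ext (N := m) Q2 _ g0 g0') //.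
  by move=> j jm; apply: gg'; lia.
exact: leq_subr.
Qed.

Lemma euler_dx (V : zmodType) (mul : V -> V -> V) (s D d : {additive V -> V})
    (Q : dgbvq_alg mul s D d) (x a : nat -> V) :
  euler (dx mul s D d x a) =
  dx mul s D d x (euler a) + bracket (conv mul) (smap s) (smap D) (euler x) a.
Proof.
rewrite /dx eulerD euler_smap !sbrE euler_conv; first by abelian.
  exact: br_additive Q.
exact: bracketBl (q_super Q).
Qed.

(** Apply [euler] to the Maurer-Cartan equation: the bracket is symmetric on even [D]-closed series,
    so the two derivative terms coincide and the result is twice the claim. *)
Lemma dx_euler (V : zmodType) (mul : V -> V -> V) (s D d : {additive V -> V})
    (Q : dgbvq_alg mul s D d) (x : nat -> V) : MC mul s D d x ->
  dx mul s D d x (euler x) = 0.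
Proof.
move=> [x0 sx Dx cx]; apply: (smulrn_eq0 Q (isT : 0 < 2)%N).
have SSA := series_super (q_super Q).
rewrite -(euler0 V) -cx /curv eulerD sbrE euler_conv; last 2 first.
- exact: br_additive Q.
- exact: bracketBl (q_super Q).
rewrite -!sbrE mulr2n eulerD euler_smap.
have sex : smap s (euler x) = euler x by rewrite -euler_smap sx.
have Dex : smap D (euler x) = 0 by rewrite -euler_smap Dx euler0.
have xC : conv mul x (euler x) = conv mul (euler x) x.
  by apply: (series_comm _ _ sx); apply: (q_comm Q).
have -> : bracket (conv mul) (smap s) (smap D) (euler x) x =
    bracket (conv mul) (smap s) (smap D) x (euler x).
  by rewrite (br_ker SSA) // (br_ker SSA) //= sx sex xC.
by rewrite /dx; abelian.
Qed.

Section Gauge.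
Variables (x : nat -> V1) (y : nat -> V2).
Hypotheses (xMC : MC mul1 s1 D1 d1 x) (yMC : MC mul2 s2 D2 d2 y).

Definition gauge_defect g : nat -> V2 := dx2 y g + euler y - Phi g (euler x).

Definition twist_defect g a : nat -> V2 := Phi g (dx1 x a) - dx2 y (Phi g a).

Section FixedGenerator.
Variable g : nat -> V2.
Hypotheses (g0 : g 0%N = 0) (Sg : S2 g = - g) (Dg : SD2 g = 0).
Notation Psi := (twist_defect g).

(** The origin of the gauge equation: after both terms of [Psi] are differentiated, what is not
    expressed through [Psi] itself collects into a single bracket with [gauge_defect g]. *)
Lemma euler_twist_defect a :
  euler (Psi a) = sbr2 g (Psi a) + Psi (euler a) - sbr2 (gauge_defect g) (Phi g a).
Proof.
have [y0 Sy Dy _] := yMC.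
pose dy : {additive (nat -> V2) -> (nat -> V2)} := HB.pack (dx2 y)
  (GRing.isZmodMorphism.Build _ _ (dx2 y) (dx_additive Q2 y)).
have dbr (b : nat -> V2) : dx2 y (sbr2 g b) = sbr2 (dx2 y g) b + sbr2 g (dx2 y b).
  exact: (@der_br_odd _ _ _ _ SSA2 dy (dx_odd_derivation Q2 Sy Dy)).
rewrite /twist_defect eulerB (euler_Phi g0) (euler_dx Q1) (euler_dx Q2) (euler_Phi g0).
rewrite (dxD Q2) dbr (sbr_additive Q2) /gauge_defect.
rewrite PhiD // Phi_sbr //.
rewrite (bracketBl SSA2) (bracketDl SSA2 (dx2 y g)).
abelian.
Qed.

(** On a constant the source term vanishes up to order [N], so [Psi] solves the flow equation there
    with initial value 0 and uniqueness applies; general series follow by [t]-linearity. *)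
Lemma twist_defect0 N : (forall m, (m <= N)%N -> gauge_defect g m = 0) ->
  forall a m, (m <= N)%N -> Psi a m = 0.
Proof.
move=> rN; have PsiM v m : (m <= N)%N -> Psi (monom 0 v) m = 0.
  have [y0 _ _ _] := yMC; have [x0 _ _ _] := xMC.
  move: m; apply: (flow_unique (z' := 0) Q2 g0 (g' := g)) => // [|m mN|m mN].
  - rewrite /twist_defect seqB Phi_0 // (dx_lead Q1) // (dx_lead Q2) // Phi_0 //.
    by rewrite fd subrr.
  - rewrite euler_twist_defect euler_monom.
    have -> : Psi 0 = 0 by rewrite /twist_defect (dxx0 Q1) Phi0 // (dxx0 Q2) subrr.
    rewrite addr0 seqB (sbrE mul2 s2 D2 (gauge_defect g)).
    rewrite (conv_vanish (a := gauge_defect g) (p := N.+1) (q := 0)).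
    + by rewrite subr0.
    + exact: (br0r Q2).
    + exact: (bracket0l SA2).
    + by move=> i; rewrite ltnS; apply: rN.
    + by [].
    + by rewrite addn0.
  - rewrite euler0; have := sbr_additive Q2 g 0 0; rewrite !subrr => -> //.
move=> a m mN; rewrite /twist_defect {1}(summ_monom a) (dx_summ Q1) Phi_summ //.
rewrite [in X in _ - X](summ_monom a) Phi_summ // (dx_summ Q2) -summB.
apply: big1 => i _; apply: PsiM; exact: leq_trans (leq_subr _ _) mN.
Qed.

(** Factoring [t] out of [b] gains one order, so that order [N] is reached while the gauge equation
    is known only below [N]. *)
Lemma twist_defect0S N b : (forall m, (m < N)%N -> gauge_defect g m = 0) ->
  b 0%N = 0 -> forall m, (m <= N)%N -> Psi b m = 0.
Proof.
move=> rN b0 m mN; rewrite -(divTK b0) /twist_defect (dx_mulT Q1) !Phi_mulT // (dx_mulT Q2).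
case: m mN => [|m] mN; first by rewrite seqB subrr.
by apply: (twist_defect0 (N := m)) => // j jm; apply: rN; lia.
Qed.

Lemma sign_gauge_defect : S2 (gauge_defect g) = gauge_defect g.
Proof.
have [y0 Sy Dy _] := yMC; have [x0 Sx _ _] := xMC.
have [_ _ ds] := dx_odd_derivation Q2 Sy Dy.
rewrite /gauge_defect raddfB raddfD /= ds /= Sg (dxN Q2) opprK -euler_smap Sy.
by rewrite -Phi_s // -euler_smap Sx.
Qed.

End FixedGenerator.

Hypotheses (xr : forall n, (1 < n)%N -> range D1 (x n))
  (yr : forall n, (1 < n)%N -> range D2 (y n)) (xy : range d2 (y 1%N - f (x 1%N))).

(* The generator of a gauge transformation carrying f(x) to y. *)
Lemma gauge_exists : exists g, [/\ g 0%N = 0, S2 g = - g, SD2 g = 0 & gauge_defect g = 0].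
Proof.
have [x0 Sx Dx _] := xMC; have [y0 Sy Dy _] := yMC.
have Dex : SD1 (euler x) = 0 by rewrite -euler_smap Dx euler0.
pose P n : set (nat -> V2) := fun g =>
  [/\ g 0%N = 0, s2 (g n) = - g n, range D2 (g n) & gauge_defect g n = 0].
suff [g gP] : exists g, forall n, P n g.
  exists g; split; first by have [] := gP 0%N.
  - by apply/funext => n; have [] := gP n.
  - by apply/funext => n; have [_ _ /(D_range Q2)] := gP n.
  - by apply/funext => n; have [] := gP n.
apply: seq_build => [n g g' gg' [g0 sg rg dg]|n g Pg gn].
  have g0' : g' 0%N = 0 by rewrite -gg'.
  split; rewrite -?gg' //; rewrite -dg /gauge_defect !seqB !seqD !dxE -gg' //.
  congr (_ + _ + _ - _).
    by apply: eq_bigr => i _; rewrite gg' // leq_subr.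
  apply: (Phi_ext (N := n)) => // m mn; rewrite gg' //; exact: ltnW.
have g0 : g 0%N = 0.
  by have [n0|n0] := posnP n; [rewrite gn // n0|have [] := Pg 0%N n0].
have Sg : S2 g = - g.
  apply/funext => m; rewrite seqN /smap; have [/Pg[]//|/gn->] := ltnP m n.
  by rewrite raddf0 oppr0.
have Dg : SD2 g = 0.
  apply/funext => m; rewrite /smap; have [/Pg[_ _ /(D_range Q2)]//|/gn->] := ltnP m n.
  by rewrite raddf0.
have gm (c : V2) m : (m < n)%N -> (g + monom n c) m = g m.
  by move=> mn; rewrite seqD /monom ltn_eqF // addr0.
have gn' (c : V2) : (g + monom n c) n = c by rewrite seqD gn // add0r /monom eqxx.
(* [Phi g (euler x)] at order [n] sees [g] only below [n], so the unknown [c] enters through [d2 c]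
   alone. *)
have defn (c : V2) : (g + monom n c) 0%N = 0 ->
    gauge_defect (g + monom n c) n = gauge_defect g n + d2 c.
  move=> gc0; rewrite /gauge_defect !seqB !seqD (dxD Q2) seqD (dx_lead Q2 (a := monom n c)) //.
    rewrite (Phi_ext (g := g + monom n c) (g' := g) (N := n)) //; last exact: gm.
    by rewrite {1}/monom eqxx; abelian.
  by move=> m mn; rewrite /monom ltn_eqF.
have [n0|n0] := posnP n.
  subst n; exists 0; have e0 : (g + monom 0 0) 0%N = 0 by rewrite gn'.
  split=> //; rewrite ?gn' ?raddf0 //; first by exists 0; rewrite ?raddf0.
  rewrite defn // raddf0 addr0 /gauge_defect seqB seqD (dx_lead Q2) // g0 raddf0.
  by rewrite (Phi_0 g0) /euler !mulr0n !(raddf0, addr0).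
have gc0 (c : V2) : (g + monom n c) 0%N = 0 by rewrite gm.
(* [dx2 y] kills the first two terms of the defect; since [dx1 x (euler x) = 0], the third yields
   [twist_defect g (euler x)], which vanishes through order [n]. *)
have dr0 : d2 (gauge_defect g n) = 0.
  rewrite -(dx_lead Q2 (x := y)) //; last by move=> m /Pg[].
  rewrite /gauge_defect (dxB Q2) (dxD Q2) (dx_dx Q2) // (dx_euler Q2) // !add0r seqN.
  have := twist_defect0S g0 Sg Dg (N := n) _ _ (leqnn n) (b := euler x).
  rewrite /twist_defect (dx_euler Q1) // Phi0 // sub0r seqN; apply; last by rewrite /euler mulr0n.
  by move=> m /Pg[].
(* At order 1 the obstruction is [y 1 - f (x 1)], exact because the classes agree and [D2]-closed;
   at higher orders the normalization of [x] and [y] puts it in [Im D2]. *)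
have [u ru] : exists u, gauge_defect g n = d2 (D2 u).
  have [n1|n1] := leqP n 1.
    have {n0 n1}n1 : n = 1%N by lia.
    have r1 : gauge_defect g n = y 1%N - f (x 1%N).
      rewrite n1 in gn *; rewrite /gauge_defect seqB seqD dxE gn // raddf0 add0r.
      rewrite /conv !big_ord_recl big_ord0 /= g0 y0 (br0r Q2) (bracket0l SA2) !addr0 add0r.
      rewrite -{1}(divTK (_ : euler x 0%N = 0)); last by rewrite /euler mulr0n.
      by rewrite Phi_mulT //= Phi_0 // /divT /euler !mulr1n.
    rewrite r1; apply: (q_exd Q2 xy); rewrite raddfB /= -fD.
    by rewrite -[D2 _]/(SD2 y 1%N) -[D1 _]/(SD1 x 1%N) Dx Dy raddf0 subrr.
  apply: (q_exD Q2) => //; rewrite /gauge_defect seqB seqD; apply: rangeD.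
    apply: rangeD; first by apply: (dx_range Q2) => //; apply: gn.
    by apply: range_muln; apply: yr.
  apply: rangeN; apply: Phi_range => //; rewrite /euler raddfMn; apply: range_muln.
  by have [v _ <-] := xr n1; rewrite fD; exists (f v).
have sr : s2 (gauge_defect g n) = gauge_defect g n.
  by rewrite -[LHS]/(S2 (gauge_defect g) n) sign_gauge_defect.
have [w [sw rw wd]] := q_even_dD Q2 sr ru.
exists (- w); split; rewrite ?gn' //.
- by rewrite raddfN /= sw.
- exact: rangeN.
by rewrite defn // raddfN wd subrr.
Qed.

Lemma Phi_lift g (l : nat -> V1) : [/\ g 0%N = 0, S2 g = - g, SD2 g = 0 & gauge_defect g = 0] ->
  ser_lift mul1 s1 D1 d1 x l -> ser_lift mul2 s2 D2 d2 y (Phi g l).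
Proof.
move=> [g0 Sg Dg rg] [Dl dl rl]; split.
- by rewrite -Phi_D // Dl Phi0.
- apply/funext => n; have := twist_defect0 g0 Sg Dg (N := n) _ l (leqnn n).
  rewrite /twist_defect dl Phi0 // sub0r seqN => /(_ _)/eqP.
  by rewrite oppr_eq0 => h; apply/eqP/h => m _; rewrite rg.
- move=> n n0; apply: Phi_range => //.
  by have [v _ <-] := rl n n0; rewrite fD; exists (f v).
Qed.

Lemma Phi_dx g a : [/\ g 0%N = 0, S2 g = - g, SD2 g = 0 & gauge_defect g = 0] ->
  Phi g (dx1 x a) = dx2 y (Phi g a).
Proof.
move=> [g0 Sg Dg rg]; apply/funext => n; apply/eqP; rewrite -subr_eq0; apply/eqP.
by apply: (twist_defect0 g0 Sg Dg (N := n)) => // m _; rewrite rg.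
Qed.

End Gauge.

End Intertwiner.

(** * Cohomology classes *)

Section Classes.
Variables (V : zmodType) (d : {additive V -> V}).

Lemma val_insubd_cocycle v : d v = 0 -> val (insubd (0 : cocycle d) v) = v.
Proof. by move=> dv; rewrite insubdK // /in_mem /= /cocycle_pred dv. Qed.

Lemma cls_eq u v : d u = 0 -> d v = 0 -> cls d u = cls d v <-> range d (u - v).
Proof.
move=> du dv; rewrite /cls.
have -> : range d (u - v) <->
    (insubd (0 : cocycle d) u - insubd (0 : cocycle d) v) \in @coboundary_pred V d.
  rewrite /in_mem /= /coboundary_pred raddfB /= !val_insubd_cocycle //.
  by split=> [?|/asboolP//]; apply/asboolP.
rewrite Quotient.idealrBE; split=> [->|/eqP] //.
Qed.

Lemma rep_cocycle (c : coh d) : d (rep c) = 0.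
Proof. by apply/eqP; exact: (valP (repr c)). Qed.

Lemma cls_rep (c : coh d) : cls d (rep c) = c.
Proof.
rewrite /cls -[RHS]reprK; congr \pi; apply: val_inj.
by rewrite val_insubd_cocycle // rep_cocycle.
Qed.

Lemma cls0 : cls d 0 = 0.
Proof.
rewrite /cls (_ : insubd _ _ = 0); last by apply: val_inj; rewrite val_insubd_cocycle ?raddf0.
exact: pi_zeror.
Qed.

End Classes.

Section Products.
Variables (V : zmodType) (mul : V -> V -> V) (s D d : {additive V -> V}).
Hypotheses (SA : super_alg mul s D) (dP : odd_derivation mul s D d).

Lemma mul_cocycle u v : d u = 0 -> d v = 0 -> d (mul u v) = 0.
Proof.
by case: dP => dM _ _ du dv; rewrite dM du dv (sup_mul0r SA) (sup_mulr0 SA) addr0.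
Qed.

Lemma cmul_cls u v : d u = 0 -> d v = 0 -> cmul mul (cls d u) (cls d v) = cls d (mul u v).
Proof.
move=> du dv; have [dM _ ds] := dP.
have /(cls_eq (rep_cocycle _) du)[p _ pu] := cls_rep (cls d u).
have /(cls_eq (rep_cocycle _) dv)[q _ qv] := cls_rep (cls d v).
rewrite /cmul; apply/cls_eq; do ?[apply: mul_cocycle => //; exact: rep_cocycle].
set a := rep (cls d u) in pu *; set b := rep (cls d v) in qv *.
have da : d a = 0 by apply: rep_cocycle.
have dsu : d (s u) = 0 by apply: oppr_inj; rewrite -ds du !raddf0.
(* [a b - u v = (d p) b + u (d q)]; the sign on [u] cancels the one in the Leibniz rule. *)
exists (mul p b + mul (s u) q) => //.
rewrite raddfD /= !dM rep_cocycle (sup_signK SA) pu qv dsu.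
rewrite (sup_mulr0 SA) (sup_mul0r SA) add0r addr0 (sup_mulBl SA) (sup_mulBr SA).
abelian.
Qed.

End Products.

(* [phi1] and [phi2] identify [E1] and [E2] with cohomology spaces and [Phi]
   induces [F] under these identifications; the products transported to [E1]
   and [E2] then correspond. *)
Lemma transported_product_natural (V1 V2 E1 E2 : zmodType)
    (mul1 : V1 -> V1 -> V1) (s1 D1 d1 : {additive V1 -> V1})
    (mul2 : V2 -> V2 -> V2) (s2 D2 d2 : {additive V2 -> V2})
    (phi1 : E1 -> coh d1) (phi2 : E2 -> coh d2) (F : E1 -> E2) (Phi : V1 -> V2) :
    super_alg mul1 s1 D1 -> odd_derivation mul1 s1 D1 d1 ->
    super_alg mul2 s2 D2 -> odd_derivation mul2 s2 D2 d2 ->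
    zmod_morphism Phi -> (forall v, Phi (d1 v) = d2 (Phi v)) ->
    (forall u v, Phi (mul1 u v) = mul2 (Phi u) (Phi v)) ->
    (forall c, exists e, phi1 e = c) -> injective phi2 ->
    (forall e, exists v, [/\ d1 v = 0, phi1 e = cls d1 v & phi2 (F e) = cls d2 (Phi v)]) ->
  forall a b,
    F (xget 0 [set e | phi1 e = cmul mul1 (phi1 a) (phi1 b)]) =
    xget 0 [set e | phi2 e = cmul mul2 (phi2 (F a)) (phi2 (F b))].
Proof.
move=> SA1 dP1 SA2 dP2 PhiB Phid PhiM surj1 inj2 nat a b.
(* Surjectivity of [phi1] makes [e] a genuine preimage rather than the default 0; injectivity of
   [phi2] finally identifies [F e] with the preimage chosen on the other side. *)
set e := xget 0 _; have eP : phi1 e = cmul mul1 (phi1 a) (phi1 b).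
  exact: (@xgetPex _ 0 [set e | phi1 e = cmul mul1 (phi1 a) (phi1 b)] (surj1 _)).
have Phi0 v : d1 v = 0 -> d2 (Phi v) = 0.
  by move=> dv; rewrite -Phid dv; have := PhiB 0 0; rewrite !subrr.
have [u [du au u2]] := nat a; have [v [dv bv v2]] := nat b; have [w [dw ew w2]] := nat e.
have Fe : phi2 (F e) = cmul mul2 (phi2 (F a)) (phi2 (F b)).
  rewrite u2 v2 w2 (cmul_cls SA2 dP2); try exact: Phi0.
  rewrite -PhiM; have duv := mul_cocycle SA1 dP1 du dv.
  apply/cls_eq; try exact: Phi0.
  have : cls d1 w = cls d1 (mul1 u v) by rewrite -ew eP au bv (cmul_cls SA1 dP1).
  by move=> /(cls_eq dw duv)[z _ zE]; exists (Phi z) => //; rewrite -Phid zE PhiB.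
by apply/esym/xget_unique => // e' /= e'P; apply: inj2; rewrite e'P Fe.
Qed.

(** * The deformed product for an even class *)

Section EvenCase.
Variables (k : algType rat) (gk : grading k) (A : dgbv gk).
Hypothesis Aq : in_DGBVq A.
Notation s := (gsign (gr A)).
Notation D := (Delta A).
Notation d := (delta A).
Notation mc := (MC *%R s D d).
Notation slift := (ser_lift *%R s D d).
Implicit Types (x y : nat -> A) (h : Hcoh A).
Let Q := dgbvq_algP Aq.

Lemma tdelta_at_summ x u : tdelta_at x (summ u) = summ (fun i => tdelta_at x (u i)).
Proof. exact: (dx_summ Q). Qed.

Lemma curv_half x n : (curv *%R s D d x n = 0) <->
  (tdelta x n + (2^-1 : rat)%:A *: tbracket x x n = 0).
Proof.
have -> : curv *%R s D d x n =
    (tdelta x n + (2^-1 : rat)%:A *: tbracket x x n) *+ 2.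
  by rewrite mulrnDl -[_ *: _]/(qdiv 2 _) qdivK // /curv seqD seqM.
by split=> [/mulrn_eq0_rat->//|->]; rewrite mul0rn.
Qed.

Lemma tMC_MC h x : tMC h x -> mc x.
Proof.
move=> [x0 sx MCx dx1 Dx1 x1h xr]; split=> //.
- by apply/funext => n; apply: sx.
- apply/funext => -[|[|n]]; rewrite /smap; first by rewrite x0 raddf0.
    exact: Dx1.
  by apply: (D_range Q); apply: xr.
- by apply/funext => n; apply/curv_half.
Qed.

(** Since [d] reverses parity, keeping the odd part [e] of the correction [u] makes [a - d e] the
    even part of [a - d u]. *)
Lemma ker_rep_even a : s a = a -> d a = 0 ->
  exists u, s (a - d u) = a - d u /\ D (a - d u) = 0.
Proof.
move=> sa da; have [u Du] := ker_rep Aq da.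
have [_ dD ds] := q_der Q; have sD := sup_signD (q_super Q).
pose e := qdiv 2 (u - s u); exists e.
have e2 : (a - d e) *+ 2 = (a - d u) + s (a - d u).
  rewrite mulrnBl -raddfMn qdivK // !raddfB /= ds sa; abelian.
split; apply: (@mulrn_inj_rat _ _ _ 2) => //; rewrite -raddfMn e2.
  by rewrite raddfD /= gsignK addrC.
have DsN b : D (s b) = - s (D b) by rewrite sD opprK.
by rewrite raddfD /= DsN Du raddf0 subrr mul0rn.
Qed.

Lemma ker_rep_odd a : s a = - a -> d a = 0 ->
  exists u, s (a - d u) = - (a - d u) /\ D (a - d u) = 0.
Proof.
move=> sa da; have [u Du] := ker_rep Aq da.
have [_ dD ds] := q_der Q; have sD := sup_signD (q_super Q).
pose e := qdiv 2 (u + s u); exists e.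
have e2 : (a - d e) *+ 2 = (a - d u) - s (a - d u).
  rewrite mulrnBl -raddfMn qdivK // raddfD raddfB /= ds sa; abelian.
split; apply: (@mulrn_inj_rat _ _ _ 2) => //; rewrite ?mulNrn -raddfMn e2.
  by rewrite raddfB /= gsignK opprB.
have DsN b : D (s b) = - s (D b) by rewrite sD opprK.
by rewrite raddfB /= DsN Du raddf0 oppr0 subrr mul0rn.
Qed.

Lemma tMC_exists h : even_class h -> exists x, tMC h x.
Proof.
move=> [a [sa da ah]]; have [u [su Du]] := ker_rep_even sa da.
have du : d (a - d u) = 0 by rewrite raddfB /= da delta2 subrr.
have [x [[x0 sx Dx cx] x1 xr]] := MC_exists Q su du Du.
exists x; split=> //; rewrite ?x1 //.
- by move=> n; rewrite /is_even -[LHS]/(smap s x n) sx.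
- by move=> n; apply/curv_half; rewrite cx.
rewrite -ah; apply/cls_eq => //; exists (- u) => //.
by rewrite raddfN /=; abelian.
Qed.

Section MaurerCartan.
Variables (h0 : Hcoh A) (x : nat -> A).
Hypothesis xMC : tMC h0 x.
Let xmc := tMC_MC xMC.
Let x0 := tMC0 xMC.

Lemma is_tliftP h y :
  is_tlift x h y <-> [/\ slift x y, d (y 0%N) = 0 & cls d (y 0%N) = h].
Proof.
split=> [[dy0 Dy0 yh dy yr]|[[Dy dy yr] dy0 yh]]; split=> //.
  split=> //; apply/funext => -[|n]; first exact: Dy0.
  by apply: (D_range Q); apply: yr.
by rewrite -[LHS]/(smap D y 0%N) Dy.
Qed.

Lemma tlift_spec h : is_tlift x h (tlift x h).
Proof.
apply: (xgetPex 0); have [u Du] := ker_rep Aq (rep_cocycle h).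
have du : d (rep h - d u) = 0 by rewrite raddfB /= rep_cocycle delta2 subrr.
have [y ly y0] := lift_exists Q xmc du Du.
exists y; apply/is_tliftP; rewrite y0; split=> //.
rewrite -[RHS]cls_rep; apply/cls_eq => //; first exact: rep_cocycle.
by exists (- u) => //; rewrite raddfN /=; abelian.
Qed.

Lemma is_tlift_unique h y y' : is_tlift x h y -> is_tlift x h y' ->
  exists w, y - y' = tdelta_at x w.
Proof.
move=> /is_tliftP[ly dy yh] /is_tliftP[ly' dy' yh'].
apply: (lift_coboundary Q xmc); first exact: (liftB Q).
by apply/cls_eq; rewrite // yh yh'.
Qed.

Lemma tphi_cocycle (eta : nat -> Hcoh A) l : (forall i, is_tlift x (eta i) (l i)) ->
  tdelta_at x (summ l) = 0.
Proof.
move=> lP; rewrite tdelta_at_summ; apply/funext => n; apply: big1 => i _.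
by have [_ _ _ /(congr1 (fun a => a (n - i)%N))] := lP i.
Qed.

(** Two lifts of a class differ by a coboundary, so any lifts compute [tphi]. This is needed because
    [Phi] sends the chosen lifts to lifts that need not be the chosen ones. *)
Lemma tphiE (eta : nat -> Hcoh A) l : (forall i, is_tlift x (eta i) (l i)) ->
  tphi x eta = cls (tdelta_at x) (summ l).
Proof.
move=> lP; have lP' i := tlift_spec (eta i).
have /choice[w wP] i := is_tlift_unique (lP' i) (lP i).
rewrite /tphi -[X in cls _ X = _]/(summ (fun i => tlift x (eta i))).
apply/cls_eq; try exact: tphi_cocycle.
exists (summ w) => //; rewrite -summB /= tdelta_at_summ; congr summ.
by apply/funext => i; rewrite wP.
Qed.

Lemma tphi_inj : injective (tphi x).
Proof.
move=> eta eta'; rewrite (tphiE (fun i => tlift_spec (eta i))).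
rewrite (tphiE (fun i => tlift_spec (eta' i))) => /cls_eq[].
- by apply: tphi_cocycle => i; apply: tlift_spec.
- by apply: tphi_cocycle => i; apply: tlift_spec.
move=> w _; rewrite -summB => wE; apply/funext => i.
have /is_tliftP[l1 d1 <-] := tlift_spec (eta i).
have /is_tliftP[l2 d2 <-] := tlift_spec (eta' i).
apply/cls_eq => //.
apply: (summ_lift_exact Q xmc (u := fun i => tlift x (eta i) - tlift x (eta' i)) (w := w)) => // j.
have /is_tliftP[lj _ _] := tlift_spec (eta j).
have /is_tliftP[lj' _ _] := tlift_spec (eta' j).
exact: (liftB Q).
Qed.

Lemma tphi_surj c : exists eta, tphi x eta = c.
Proof.
have [l [w [ll rE]]] := summ_lift_decomp Q xmc (rep_cocycle c).
exists (fun i => cls d (l i 0%N)).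
have lP i : is_tlift x (cls d (l i 0%N)) (l i).
  by apply/is_tliftP; split=> //; apply: (lift_d0 Q x0).
rewrite (tphiE lP) -[RHS]cls_rep; apply/cls_eq.
- exact: tphi_cocycle lP.
- exact: rep_cocycle.
by exists (- w); rewrite // raddfN rE; abelian.
Qed.

Lemma tdelta_at_derivation :
  odd_derivation (conv *%R) (smap s) (smap D) (tdelta_at x).
Proof. by case: xmc => _ sx Dx _; apply: (dx_odd_derivation Q). Qed.

End MaurerCartan.

End EvenCase.

(** * Naturality for even classes *)

Section Homomorphism.
Variables (k : algType rat) (gk : grading k) (A1 A2 : dgbv gk) (f : dgbv_hom A1 A2).

Lemma hom_gsign u : f (gsign (gr A1) u) = gsign (gr A2) (f u).
Proof.
elim/(@homog_ind _ (gr A1)): u => [|u v IHu IHv|i u hu]; first by rewrite !raddf0.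
  by rewrite !raddfD /= IHu IHv.
have hfu : homog (gr A2) i (f u) by rewrite /homog -hom_gr hu.
by rewrite (gsign_homog hu) (gsign_homog hfu); case: ifP => // _; rewrite raddfN.
Qed.

Lemma hom_coh_cls u : delta A1 u = 0 -> hom_coh f (cls (delta A1) u) = cls (delta A2) (f u).
Proof.
move=> du; have /(cls_eq (rep_cocycle _) du)[v _ vE] := cls_rep (cls (delta A1) u).
apply/cls_eq; rewrite -?hom_delta ?rep_cocycle ?du ?raddf0 //.
by exists (f v) => //; rewrite -hom_delta vE raddfB.
Qed.

Lemma hom_coh0 : hom_coh f 0 = 0.
Proof. by rewrite -[X in hom_coh f X]cls0 hom_coh_cls ?raddf0 // cls0. Qed.

Hypotheses (A1q : in_DGBVq A1) (A2q : in_DGBVq A2).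
Let Q1 := dgbvq_algP A1q.
Let Q2 := dgbvq_algP A2q.

(** Only the leading classes relate [x] and [y]; with [f] the identity this shows that the product
    does not depend on the normalized solution. *)
Lemma twedge_natural h x y : tMC h x -> tMC (hom_coh f h) y ->
  forall a b, hom_coht f (twedge x a b) = twedge y (hom_coht f a) (hom_coht f b).
Proof.
move=> xM yM; have xmc := tMC_MC A1q xM; have ymc := tMC_MC A2q yM.
have fM : forall u v, f (u * v) = f u * f v by apply: rmorphM.
have xy : range (delta A2) (y 1%N - f (x 1%N)).
  apply/cls_eq; first exact: tMC1_delta yM.
    by rewrite -hom_delta (tMC1_delta xM) raddf0.
  by rewrite (tMC1_cls yM) -hom_coh_cls ?(tMC1_delta xM) // (tMC1_cls xM).
have [g gP] := @gauge_exists A1 A2 _ _ _ _ _ _ _ _ Q1 Q2 f fM hom_gsign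
  (hom_Delta f) (hom_delta f) x y xmc ymc (tMC_range xM) (tMC_range yM) xy.
have [g0 Sg Dg _] := gP.
pose Ph := @Phi A1 A2 *%R (gsign (gr A2)) (Delta A2) f g.
apply: (@transported_product_natural _ _ _ _ (conv *%R) (smap (gsign (gr A1))) (smap (Delta A1)) _
  (conv *%R) (smap (gsign (gr A2))) (smap (Delta A2)) _ _ _ _ Ph).
- exact: series_super (q_super Q1).
- exact: tdelta_at_derivation xM.
- exact: series_super (q_super Q2).
- exact: tdelta_at_derivation yM.
- by move=> u v; apply: (PhiB Q2).
- by move=> v; apply: (Phi_dx Q1 Q2 fM hom_gsign (hom_Delta f) (hom_delta f) xmc ymc).
- by move=> u v; apply: (Phi_mul Q2 fM).
- exact: tphi_surj xM.
- exact: tphi_inj yM.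
move=> eta; have lP i := tlift_spec A1q xM (eta i).
exists (summ (fun i => tlift x (eta i))); split.
- exact: (tphi_cocycle A1q lP).
- exact: (tphiE A1q xM lP).
rewrite /Ph (Phi_summ Q2) //; apply: (tphiE A2q yM) => i.
have /(is_tliftP A1q)[li di ei] := lP i.
apply/(is_tliftP A2q).
rewrite (Phi_0 Q2) // -hom_delta di raddf0 -hom_coh_cls // ei; split=> //.
by apply: (Phi_lift Q1 Q2 fM hom_gsign (hom_Delta f) (hom_delta f) xmc ymc gP).
Qed.

Lemma hom_coht_const h : hom_coht f (tconst h) = tconst (hom_coh f h).
Proof. by apply/funext => -[|n] //; rewrite /hom_coht /tconst /= hom_coh0. Qed.

End Homomorphism.

(** * The deformed product for an odd class *)

Section PairMaps.
Variables (V : zmodType) (s D : {additive V -> V}).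

Definition pair_map (a : V * V) : V * V := (D a.1, D a.2).
Definition pair_sign (a : V * V) : V * V := (s a.1, - s a.2).

Lemma pair_map_additive : zmod_morphism pair_map.
Proof. by move=> a b; rewrite /pair_map !raddfB. Qed.

Lemma pair_sign_additive : zmod_morphism pair_sign.
Proof. by move=> a b; congr (_, _); rewrite !raddfB. Qed.

HB.instance Definition _ :=
  GRing.isZmodMorphism.Build (V * V)%type (V * V)%type pair_map pair_map_additive.
HB.instance Definition _ :=
  GRing.isZmodMorphism.Build (V * V)%type (V * V)%type pair_sign pair_sign_additive.
End PairMaps.

Section Pairs.
Variables (V : zmodType) (mul : V -> V -> V) (s D d : {additive V -> V}).
Hypothesis Q : dgbvq_alg mul s D d.
Notation br := (bracket mul s D).
Let SA := q_super Q.

Definition pair_mul (a b : V * V) : V * V := (mul a.1 b.1, mul a.1 b.2 + mul a.2 (s b.1)).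
Notation pbr := (bracket pair_mul (pair_sign s) (pair_map D)).

Lemma pair_super : super_alg pair_mul (pair_sign s) (pair_map D).
Proof.
split.
- move=> a b c; congr (_, _) => /=; first exact: (sup_mulBr SA).
  by rewrite raddfB !(sup_mulBr SA); abelian.
- move=> a b c; congr (_, _) => /=; first exact: (sup_mulBl SA).
  by rewrite !(sup_mulBl SA); abelian.
- move=> a b; congr (_, _) => /=; first exact: (sup_signM SA).
  rewrite raddfD /= !(sup_signM SA) (sup_mulrN SA) (sup_mulNr SA); abelian.
- by move=> [a b]; rewrite /= /pair_sign /= raddfN /= !(sup_signK SA) opprK.
- move=> a; congr (_, _) => /=; rewrite (sup_signD SA) //.
  by rewrite raddfN.
- by move=> a; rewrite /= /pair_map /= !(sup_DD SA).
Qed.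

Lemma pair_odd_derivation : odd_derivation pair_mul (pair_sign s) (pair_map D) (pair_map d).
Proof.
have [dM dD ds] := q_der Q; split.
- move=> a b; congr (_, _) => /=; first exact: dM.
  rewrite raddfD /= !dM (sup_mulNr SA) ds (sup_mulrN SA); abelian.
- by move=> a; congr (_, _) => /=; rewrite dD.
- by move=> a; congr (_, _) => /=; rewrite ds // raddfN.
Qed.

(** As [eps] squares to zero only the constant part of [b] contributes, and moving [eps] past it
    produces the sign operator. *)
Lemma pbrE u b : pbr (0, u) b = (0, - br u (s b.1)).
Proof.
rewrite /bracket /pair_sign /pair_map /pair_mul /=; congr (_, _) => /=.
  by rewrite !raddf0 !(sup_mul0r SA) raddf0 !subr0.
rewrite !(raddf0, sup_mul0r SA, raddfD, raddfN, sup_mulNr SA) /=.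
rewrite (sup_signD SA) (sup_mulrN SA); abelian.
Qed.

Lemma pbr_odd_derivation u : s u = - u -> D u = 0 ->
  odd_derivation pair_mul (pair_sign s) (pair_map D) (pbr (0, u)).
Proof.
move=> su Du; apply: (br_odd_derivation pair_super).
- by rewrite /= /pair_sign /= su opprK raddf0.
- by rewrite /= /pair_map /= Du raddf0.
move=> a b; rewrite !pbrE /pair_mul /=; congr (_, _).
  by rewrite (sup_mul0r SA) (sup_mulr0 SA) addr0.
rewrite (sup_signM SA) (q_odd_Poisson Q) // !(sup_mul0r SA) raddf0 !(sup_mulr0 SA).
by rewrite (sup_mulrN SA) !(sup_mulNr SA) /=; abelian.
Qed.

(* [x] stands for [x eps] with [x] odd, and [pdx x] for the differential
   twisted by it. *)
Definition pdx (x : V) (a : V * V) : V * V := (d a.1, d a.2 - br x (s a.1)).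

Lemma pdxE x a : pair_map d a + pbr (0, x) a = pdx x a.
Proof. by rewrite pbrE; congr (_, _); rewrite /= ?addr0. Qed.

Lemma pdxB x a b : pdx x (a - b) = pdx x a - pdx x b.
Proof.
rewrite /pdx; congr (_, _) => /=; first by rewrite raddfB.
by rewrite (raddfB d) (raddfB s) (br_additive Q); abelian.
Qed.

Section Lifts.
Variable x : V.
Hypotheses (sx : s x = - x) (dx0 : d x = 0) (Dx : D x = 0).

Lemma pdx_pdx a : pdx x (pdx x a) = 0.
Proof.
have [_ _ ds] := q_der Q; congr (_, _) => /=; first exact: (q_dd Q).
rewrite raddfB /= (q_dd Q) (der_br_odd SA (q_der Q)) // dx0 (bracket0l SA) ds.
rewrite (bracketNr SA); abelian.
Qed.

Lemma br_sign_range v : D v = 0 -> range D (br x (s v)).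
Proof.
move=> Dv; have Dsv : D (s v) = 0.
  by apply: oppr_inj; rewrite -(sup_signD SA) Dv !raddf0.
by rewrite (br_ker SA) //; exists (mul (s x) (s v)).
Qed.

Record plift (l : V * V) : Prop := PLift {
  plift_d : d l.1 = 0;
  plift_D : D l.1 = 0;
  plift_dx : pdx x l = 0;
  plift_range : range D l.2
}.

(** The recursion for series stops after one step here: [[x, s v]] is [d]-closed and [D]-exact. *)
Lemma plift_exists v : d v = 0 -> D v = 0 -> exists2 l, plift l & l.1 = v.
Proof.
move=> dv Dv; have [_ _ ds] := q_der Q.
have db : d (br x (s v)) = 0.
  rewrite (der_br_odd SA (q_der Q)) // dx0 (bracket0l SA) -[d (s v)]opprK -ds dv.
  by rewrite raddf0 oppr0 (br0r Q) addr0.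
have [u uE] := q_exD Q (br_sign_range Dv) db.
exists (v, D u) => //; split=> //.
by rewrite /pdx /= dv uE subrr.
Qed.

Lemma pliftB l l' : plift l -> plift l' -> plift (l - l').
Proof.
move=> [dl Dl el rl] [dl' Dl' el' rl']; split => /=.
- by rewrite raddfB /= dl dl' subrr.
- by rewrite raddfB /= Dl Dl' subrr.
- by rewrite pdxB el el' subrr.
- by apply: rangeD rl _; apply: rangeN.
Qed.

(** With [l.1 = d (D u)], subtracting [pdx x (D u, 0)] leaves a cocycle [(0, r)] with [r] in [Im D],
    so that [r = d (D v)]. *)
Lemma plift_coboundary l : plift l -> range d l.1 -> exists w, l = pdx x w.
Proof.
move=> [dl Dl el rl] rd; have [u lu] := q_exd Q rd Dl; move=> {rd}.
have := pdx_pdx (D u, 0); rewrite -[pdx x (D u, 0)]/(d (D u), d 0 - br x (s (D u))) => pu.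
have DDu : D (D u) = 0 := sup_DD SA u.
pose r := l.2 + br x (s (D u)).
have rr : range D r by apply: rangeD rl _; apply: br_sign_range.
have dr : d r = 0.
  have : pdx x (l - (d (D u), d 0 - br x (s (D u)))) = 0 by rewrite pdxB el pu subrr.
  move/(congr1 snd); rewrite /pdx /= lu subrr !raddf0 (br0r Q) subr0 => h.
  by rewrite /r -[RHS]h; congr (d _); abelian.
have [v rv] := q_exD Q rr dr.
exists (D u, D v); case: l lu @r rr dr rv {dl Dl el rl} => l1 l2 /= -> _ _ rv.
by rewrite /pdx /= -rv; congr (_, _); abelian.
Qed.

Lemma plift_pair_cocycle l l' : plift l -> plift l' -> pdx x (l.1, l.2 + l'.1) = 0.
Proof.
move=> [dl _ /(congr1 snd) /= el _] [dl' _ _ _].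
by rewrite /pdx /= dl raddfD /= dl' addr0 el.
Qed.

(** As for series, a primitive of [(0, l'.1)] is altered by a lift and a coboundary until its
    constant term vanishes; its second component is then a primitive of [l'.1] for [d]. *)
Lemma plift_pair_exact l l' w : plift l -> plift l' -> (l.1, l.2 + l'.1) = pdx x w ->
  range d l.1 /\ range d l'.1.
Proof.
move=> ll ll' lw; have r1 : range d l.1 by exists w.1 => //; case: lw.
split=> //; have [w' lw'] := plift_coboundary ll r1.
have lww : (0, l'.1) = pdx x (w - w').
  by rewrite pdxB -lw -lw'; congr (_, _) => /=; rewrite ?subrr //; abelian.
have dc : d (w - w').1 = 0 by have /(congr1 fst) /= := lww.
have [e De] := q_rep Q dc.
have dce : d ((w - w').1 - d e) = 0 by rewrite raddfB /= dc (q_dd Q) subrr.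
have [m ml mE] := plift_exists dce De.
have := congr1 (fun a => a - pdx x m - pdx x (pdx x (e, 0))) lww.
rewrite -!pdxB pdx_pdx (plift_dx ml) !subr0 => /(congr1 snd).
rewrite /pdx /= mE.
have -> : w.1 - w'.1 - (w.1 - w'.1 - d e) - d e = 0 by abelian.
by rewrite (raddf0 s) (br0r Q) subr0 => ->; exact: imageT.
Qed.

Lemma plift_pair_decomp v : pdx x v = 0 ->
  exists l l' w, [/\ plift l, plift l' & v = (l.1, l.2 + l'.1) + pdx x w].
Proof.
move=> dv; have dv1 : d v.1 = 0 by have /(congr1 fst) := dv.
have [e De] := q_rep Q dv1.
have de : d (v.1 - d e) = 0 by rewrite raddfB /= dv1 (q_dd Q) subrr.
have [l ll lE] := plift_exists de De.
(* The [eps]-coefficient of [v - l - pdx x (e, 0)], whose constant term is 0. *)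
pose r := v.2 - l.2 + br x (s e).
have dr : d r = 0.
  have : pdx x (v - l - pdx x (e, 0)) = 0 by rewrite !pdxB dv (plift_dx ll) pdx_pdx !subr0.
  move/(congr1 snd); rewrite /pdx /= lE.
  have -> : v.1 - (v.1 - d e) - d e = 0 by abelian.
  rewrite !raddf0 (br0r Q) subr0 => h.
  by rewrite /r -[RHS]h; congr (d _); abelian.
have [e' De'] := q_rep Q dr.
have de' : d (r - d e') = 0 by rewrite raddfB /= dr (q_dd Q) subrr.
have [l' ll' lE'] := plift_exists de' De'.
exists l, l', (e, e'); split=> //.
case: v @r l' {dv dv1 De de dr De' de' ll'} lE lE' => v1 v2 /= l' lE lE'.
by rewrite /pdx /= lE lE'; congr (_, _) => /=; abelian.
Qed.

End Lifts.
End Pairs.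

(** * The gauge transformation over the odd parameter *)

Section PairGauge.
Variables (V1 V2 : zmodType).
Variables (mul1 : V1 -> V1 -> V1) (s1 D1 d1 : {additive V1 -> V1}).
Variables (mul2 : V2 -> V2 -> V2) (s2 D2 d2 : {additive V2 -> V2}).
Hypotheses (Q1 : dgbvq_alg mul1 s1 D1 d1) (Q2 : dgbvq_alg mul2 s2 D2 d2).
Variable f : {additive V1 -> V2}.
Hypotheses (fM : forall u v, f (mul1 u v) = mul2 (f u) (f v))
  (fs : forall u, f (s1 u) = s2 (f u)) (fD : forall u, f (D1 u) = D2 (f u))
  (fd : forall u, f (d1 u) = d2 (f u)).
Notation br2 := (bracket mul2 s2 D2).
Let SA2 := q_super Q2.

Lemma hom_bracket u v : f (bracket mul1 s1 D1 u v) = br2 (f u) (f v).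
Proof. by rewrite /bracket !raddfB /= !(fM, fD, fs). Qed.

(* [f] followed by the exponential of the bracket with [w eps], whose square
   vanishes. *)
Definition pPhi (w : V2) (a : V1 * V1) : V2 * V2 :=
  (f a.1, f a.2 - br2 w (s2 (f a.1))).

Lemma pPhiB w : zmod_morphism (pPhi w).
Proof.
move=> a b; congr (_, _) => /=; first by rewrite raddfB.
by rewrite (raddfB f) (raddfB f) (raddfB s2) (br_additive Q2); abelian.
Qed.

Variables (x : V1) (y w : V2).
Hypotheses (sw : s2 w = w) (Dw : range D2 w) (dw : d2 w = f x - y).

Lemma pPhi_mul a b : pPhi w (pair_mul mul1 s1 a b) = pair_mul mul2 s2 (pPhi w a) (pPhi w b).
Proof.
congr (_, _) => /=; first exact: fM.
rewrite raddfD /= !fM fs (sup_signM SA2) (q_even_Poisson Q2) // (sup_signK SA2).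
by rewrite (sup_mulBr SA2 _ (f b.2)) (sup_mulBl SA2 _ (f a.2)); abelian.
Qed.

(** The graded commutator of [d2] with the bracket by [w] is the bracket with [d2 w = f x - y], the
    difference of the two twists. *)
Lemma pPhi_dx a : pPhi w (pdx mul1 s1 D1 d1 x a) = pdx mul2 s2 D2 d2 y (pPhi w a).
Proof.
have [_ _ ds] := q_der Q2; have Dw0 := D_range Q2 Dw.
congr (_, _) => /=; first exact: fd.
rewrite (raddfB f (d1 a.2)) (raddfB d2 (f a.2)) hom_bracket fs.
rewrite (der_br_even SA2 (q_der Q2)) // dw (bracketBl SA2 _ (f x)).
by rewrite !fd ds (bracketNr SA2); abelian.
Qed.

Lemma pPhi_lift l : plift mul1 s1 D1 d1 x l -> plift mul2 s2 D2 d2 y (pPhi w l).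
Proof.
move=> [dl Dl el rl]; have Dw0 := D_range Q2 Dw; split=> /=.
- by rewrite -fd dl raddf0.
- by rewrite -fD Dl raddf0.
- by rewrite -pPhi_dx el; have := pPhiB w 0 0; rewrite !subrr.
apply: rangeD; first by have [v _ <-] := rl; rewrite fD; exists (f v).
by apply: rangeN; apply: (br_sign_range Q2) => //; rewrite -fD Dl raddf0.
Qed.

End PairGauge.

(** * The identification of cohomology for an odd class *)

Section OddCase.
Variables (k : algType rat) (gk : grading k) (A : dgbv gk).
Hypothesis Aq : in_DGBVq A.
Notation s := (gsign (gr A)).
Notation D := (Delta A).
Notation d := (delta A).
Implicit Types (h : Hcoh A).
Let Q := dgbvq_algP Aq.

Lemma eMC_exists h : odd_class h -> exists xe, eMC h xe.
Proof.
move=> [a [sa da ah]]; have [u [su Du]] := ker_rep_odd Aq sa da.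
have du : d (a - d u) = 0 by rewrite raddfB /= da delta2 subrr.
exists (0, a - d u); split=> //=.
rewrite -ah; apply/cls_eq => //; exists (- u) => //.
by rewrite raddfN /=; abelian.
Qed.

Section MaurerCartan.
Variables (h0 : Hcoh A) (x : A).
Hypothesis xMC : eMC h0 (0, x).
Notation ed := (edelta_at (0, x)).
Notation plft := (plift *%R s D d x).
Let sx : s x = - x := eMC_odd xMC.
Let dx0 : d x = 0 := eMC_delta xMC.
Let Dx : D x = 0 := eMC_Delta xMC.

Lemma edelta_atE y : ed y = pdx *%R s D d x y.
Proof. exact: (pdxE Q). Qed.

Lemma edelta_at_derivation : odd_derivation (pair_mul *%R s) (pair_sign s) (pair_map D) ed.
Proof.
apply: (odd_derivationD (pair_super Q) (pair_odd_derivation Q)).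
exact: (pbr_odd_derivation Q sx Dx).
Qed.

Lemma is_eliftP h y : is_elift (0, x) h y <-> plft y /\ cls d y.1 = h.
Proof.
split=> [[dy Dy yh]|[[dy Dy ey ry] yh]]; rewrite /is_elift edelta_atE; last by split.
by move=> ey ry; split.
Qed.

Lemma elift_spec h : is_elift (0, x) h (elift (0, x) h).
Proof.
apply: (xgetPex 0); have [u Du] := ker_rep Aq (rep_cocycle h).
have du : d (rep h - d u) = 0 by rewrite raddfB /= rep_cocycle delta2 subrr.
have [l ll l1] := plift_exists Q sx dx0 Dx du Du.
exists l; apply/is_eliftP; split=> //; rewrite l1 -[RHS]cls_rep; apply/cls_eq => //.
  exact: rep_cocycle.
by exists (- u) => //; rewrite raddfN /=; abelian.
Qed.

Lemma ephi_cocycle h h' l l' : is_elift (0, x) h l -> is_elift (0, x) h' l' ->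
  ed (l.1, l.2 + l'.1) = 0.
Proof.
move=> /is_eliftP[ll _] /is_eliftP[ll' _]; rewrite edelta_atE.
exact: plift_pair_cocycle.
Qed.

Lemma ephiE (eta : Hcoh A * Hcoh A) l l' :
    is_elift (0, x) eta.1 l -> is_elift (0, x) eta.2 l' ->
  ephi (0, x) eta = cls ed (l.1, l.2 + l'.1).
Proof.
move=> lP lP'; have mP := elift_spec eta.1; have mP' := elift_spec eta.2.
rewrite /ephi; apply/cls_eq; [exact: ephi_cocycle mP mP'|exact: ephi_cocycle lP lP'|].
have /is_eliftP[ll le] := lP; have /is_eliftP[ll' le'] := lP'.
have /is_eliftP[ml me] := mP; have /is_eliftP[ml' me'] := mP'.
have [|w wE] := plift_coboundary Q sx dx0 Dx (pliftB Q ml ll).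
  by apply/cls_eq; [exact: plift_d ml|exact: plift_d ll|rewrite me le].
have /cls_eq[||v _ vE] : cls d (elift (0, x) eta.2).1 = cls d l'.1 by rewrite me' le'.
- exact: plift_d ml'.
- exact: plift_d ll'.
(* [w] bounds the difference of the lifts of [eta.1], and [v] that of the constant terms of the
   lifts of [eta.2], which is all that survives multiplication by [eps]. *)
exists (w.1, w.2 + v) => //=; rewrite edelta_atE.
move: wE vE; rewrite /pdx; case: w => w1 w2 /= [<- w2E] vE.
congr (_, _) => /=; rewrite raddfD /= vE.
have -> : d w2 = (elift (0, x) eta.1).2 - l.2 + bracket *%R s D x (s w1).
  by rewrite w2E subrK.
abelian.
Qed.

Lemma ephi_inj : injective (ephi (0, x)).
Proof.
move=> eta eta'.
have lP := elift_spec eta.1; have lP' := elift_spec eta.2.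
have mP := elift_spec eta'.1; have mP' := elift_spec eta'.2.
rewrite (ephiE lP lP') (ephiE mP mP') => /cls_eq[].
- exact: ephi_cocycle lP lP'.
- exact: ephi_cocycle mP mP'.
move=> w _ /=; rewrite edelta_atE => wE.
have /is_eliftP[ll le] := lP; have /is_eliftP[ll' le'] := lP'.
have /is_eliftP[ml me] := mP; have /is_eliftP[ml' me'] := mP'.
have [|r1 r2] := plift_pair_exact Q sx dx0 Dx (w := w) (pliftB Q ll ml) (pliftB Q ll' ml').
  by rewrite wE; congr (_, _) => /=; abelian.
rewrite [eta]surjective_pairing [eta']surjective_pairing -le -le' -me -me'.
congr (_, _); apply/cls_eq => //.
- exact: plift_d ll.
- exact: plift_d ml.
- exact: plift_d ll'.
- exact: plift_d ml'.
Qed.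

Lemma ephi_surj c : exists eta, ephi (0, x) eta = c.
Proof.
have rc : pdx *%R s D d x (rep c) = 0 by rewrite -edelta_atE; exact: rep_cocycle.
have [l [l' [w [ll ll' rE]]]] := plift_pair_decomp Q sx dx0 Dx rc.
exists (cls d l.1, cls d l'.1).
have lP : is_elift (0, x) (cls d l.1) l by apply/is_eliftP.
have lP' : is_elift (0, x) (cls d l'.1) l' by apply/is_eliftP.
rewrite (ephiE (eta := (_, _)) lP lP') -[RHS]cls_rep; apply/cls_eq.
- exact: ephi_cocycle lP lP'.
- exact: rep_cocycle.
exists (- w) => //; rewrite raddfN /= edelta_atE rE; abelian.
Qed.

End MaurerCartan.
End OddCase.

(** * Naturality for odd classes *)

Section OddHomomorphism.
Variables (k : algType rat) (gk : grading k) (A1 A2 : dgbv gk) (f : dgbv_hom A1 A2).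
Hypotheses (A1q : in_DGBVq A1) (A2q : in_DGBVq A2).
Let Q1 := dgbvq_algP A1q.
Let Q2 := dgbvq_algP A2q.

Lemma ewedge_natural h xe ye : eMC h xe -> eMC (hom_coh f h) ye ->
  forall a b, hom_cohe f (ewedge xe a b) = ewedge ye (hom_cohe f a) (hom_cohe f b).
Proof.
case: xe ye => [x1 x] [y1 y] xM yM.
have xM0 := eMC0 xM; have yM0 := eMC0 yM; rewrite /= in xM0 yM0; subst x1 y1.
have fM : forall u v, f (u * v) = f u * f v by apply: rmorphM.
have dfx : delta A2 (f x) = 0 by rewrite -hom_delta (eMC_delta xM) raddf0.
have xy : range (delta A2) (f x - y).
  apply/cls_eq; [exact: dfx|exact: eMC_delta yM|].
  by rewrite (eMC_cls yM) -hom_coh_cls ?(eMC_delta xM) // (eMC_cls xM).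
have Dxy : Delta A2 (f x - y) = 0.
  by rewrite raddfB /= -hom_Delta (eMC_Delta xM) (eMC_Delta yM) raddf0 subrr.
have sxy : gsign (gr A2) (f x - y) = - (f x - y).
  by rewrite raddfB /= -hom_gsign (eMC_odd xM) (eMC_odd yM) raddfN opprD.
(* The difference [f x - y] is odd, so its primitive [w] can be taken even, which makes [w eps] odd
   like the generator in the series case. *)
have [u uE] := q_exd Q2 xy Dxy.
have [w [sw rw /esym dw]] := q_odd_dD Q2 sxy uE.
pose Ph := @pPhi A1 A2 *%R (gsign (gr A2)) (Delta A2) f w.
have fs := hom_gsign f; have fD := hom_Delta f; have fd := hom_delta f.
apply: (@transported_product_natural _ _ _ _
  (pair_mul *%R (gsign (gr A1))) (pair_sign (gsign (gr A1))) (pair_map (Delta A1)) _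
  (pair_mul *%R (gsign (gr A2))) (pair_sign (gsign (gr A2))) (pair_map (Delta A2)) _ _ _ _ Ph).
- exact: pair_super Q1.
- exact: edelta_at_derivation xM.
- exact: pair_super Q2.
- exact: edelta_at_derivation yM.
- exact: (pPhiB Q2).
- move=> v /=; rewrite (edelta_atE A1q) (edelta_atE A2q).
  exact: (pPhi_dx Q2 fM fs fD fd sw rw dw).
- by move=> a b; apply: (pPhi_mul Q2 fM fs sw).
- exact: ephi_surj xM.
- exact: ephi_inj yM.
move=> eta; have lP := elift_spec A1q xM eta.1; have lP' := elift_spec A1q xM eta.2.
set l := elift _ _ in lP; set l' := elift _ _ in lP'.
have lift2 h' m : is_elift (0, x) h' m -> is_elift (0, y) (hom_coh f h') (Ph m).
  move=> /(is_eliftP A1q)[lm <-]; apply/(is_eliftP A2q); split.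
    exact: (pPhi_lift Q2 fM fs fD fd sw rw dw).
  by rewrite /= hom_coh_cls // (plift_d lm).
exists (l.1, l.2 + l'.1); split.
- exact: ephi_cocycle lP lP'.
- exact: (ephiE A1q xM lP lP').
rewrite (ephiE A2q yM (eta := hom_cohe f eta) (lift2 _ _ lP) (lift2 _ _ lP')).
congr cls; congr (_, _) => /=.
by rewrite (raddfD f l.2); abelian.
Qed.

Lemma hom_cohe_const h : hom_cohe f (econst h) = econst (hom_coh f h).
Proof. by rewrite /hom_cohe /econst /= hom_coh0. Qed.

End OddHomomorphism.

Theorem theorem3p1 (k : algType rat) (gk : grading k) (gcomm_k : gcomm_ring gk)
    (A1 A2 : dgbv gk) (A1q : in_DGBVq A1) (A2q : in_DGBVq A2)
    (f : dgbv_hom A1 A2) :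
  (forall x : Hcoh A1, even_class x ->
     (exists xt, tMC x xt) /\
     (forall xt yt, tMC x xt -> tMC (hom_coh f x) yt ->
      forall alpha beta : Hcoh A1,
        hom_coht f (twedge xt (tconst alpha) (tconst beta)) =
        twedge yt (tconst (hom_coh f alpha)) (tconst (hom_coh f beta)))) /\
  (forall x : Hcoh A1, odd_class x ->
     (exists xe, eMC x xe) /\
     (forall xe ye, eMC x xe -> eMC (hom_coh f x) ye ->
      forall alpha beta : Hcoh A1,
        hom_cohe f (ewedge xe (econst alpha) (econst beta)) =
        ewedge ye (econst (hom_coh f alpha)) (econst (hom_coh f beta)))).
Proof.
split=> x xP; split.
- exact: tMC_exists.
- move=> xt yt xM yM a b.
  by rewrite (twedge_natural A1q A2q xM yM) !hom_coht_const.
- exact: eMC_exists.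
- move=> xe ye xM yM a b.
  by rewrite (ewedge_natural A1q A2q xM yM) !hom_cohe_const.
Qed.
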